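(* Let $M$ be one of the orientable three-dimensional Bieberbach manifolds $G2,G3,G4,G5,G6$ (that is, other than the torus itself), $M=\mathbb{T}^3/G$ with $n=|G|$, with any of its spin structures. Let $D_M$ be the Dirac operator on $M$ projected from the equilateral Dirac operator $D^3_\tau$ on the three-torus (all as defined in the context). For a continuous cut-off function $f$ on $\mathbb{R}$, not necessarily even, to which the Poisson summation formula is applicable, define the spectral actions $$\mathcal{S}(M,\Lambda)=\sum_{\lambda\in \mathrm{Sp}(D_M)} f\!\left(\frac{\lambda}{\Lambda}\right),\qquad \mathcal{S}(\mathbb{T}^3,\Lambda)=\sum_{\lambda\in \mathrm{Sp}(D^3_\tau)} f\!\left(\frac{\lambda}{\Lambda}\right).$$ Then the nonperturbative spectral action over $M$ is, up to a scaling (by the factor $\frac1n$) and up to order $o(\Lambda^{-1})$, indistinguishable from the spectral action over the three-torus: $$\mathcal{S}(M,\Lambda)=\frac1n\,\mathcal{S}(\mathbb{T}^3,\Lambda)+o(\Lambda^{-1})\qquad\text{for large }\Lambda .$$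
   Context: Spectra are counted with multiplicities. Manifolds: view the algebra of functions on $\mathbb{T}^3$ as generated by three commuting unitaries $U,V,W$. The manifolds are the quotients of $\mathbb{T}^3$ by the following free actions of a finite group $G$ (with generator $e$, or generators $e_1,e_2$). - $G2$: $G=\mathbb{Z}_2$, $U\mapsto -U$, $V\mapsto V^*$, $W\mapsto W^*$. - $G3$: $G=\mathbb{Z}_3$, $U\mapsto e^{2\pi i/3}U$, $V\mapsto W^*$, $W\mapsto W^*V$. - $G4$: $G=\mathbb{Z}_4$, $U\mapsto iU$, $V\mapsto W$, $W\mapsto V^*$. - $G5$: $G=\mathbb{Z}_6$, $U\mapsto e^{\pi i/3}U$, $V\mapsto W$, $W\mapsto WV^*$. - $G6$: $G=\mathbb{Z}_2\times\mathbb{Z}_2$, $e_1$: $U\mapsto -U$, $V\mapsto V^*$, $W\mapsto W^*$; $e_2$: $U\mapsto U^*$, $V\mapsto -V$, $W\mapsto -W^*$. Equilateral torus Dirac operator: for $\tau\in\mathbb{C}\setminus\mathbb{R}$, $|\tau|=1$, and a spin structure of $\mathbb{T}^3$ labelled by $\epsilon_1,\epsilon_2,\epsilon_3\in\{0,\frac12\}$, $D^3_\tau$ is the Dirac operator of the flat torus with three fundamental circles of equal length. Its spectrum consists of both numbers $\pm\sqrt{(k+\epsilon_1)^2+|l+\epsilon_2+\tau(m+\epsilon_3)|^2}$ for each $(k,l,m)\in\mathbb{Z}^3$. Projected Dirac operator: a spin structure on $M$ comes from a spin structure on $\mathbb{T}^3$ that is projectable to the quotient, together with a lift of the $G$-action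 to spinors. The parameter $\tau$ is such that $D^3_\tau$ commutes with the action of $G$ (for $G2$ and $G6$ one takes $\tau=i$). $D_M$ is the restriction of $D^3_\tau$ to the $G$-invariant spinors, i.e. the Dirac operator of $M$ with the flat metric and this spin structure. $\mathcal{S}(\mathbb{T}^3,\Lambda)$ is taken with the same $\tau$ and with the torus spin structure from which that of $M$ is projected.
   Formalization: The cut-off function f is additionally required to have a Fourier transform that is o(ξ^-2) at infinity (true for Schwartz functions); with the Poisson summation formula alone the o(Λ^-1) claim fails, e.g. for an odd piecewise-linear f on G2. *)

(* Defs.v *)
From HB Require Import structures.
From mathcomp Require Export all_boot all_order all_algebra all_fingroup.
From mathcomp Require Export complex.
From mathcomp Require Export all_classical all_reals all_analysis.

Set Implicit Arguments.
Unset Strict Implicit.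
Unset Printing Implicit Defensive.

Export Order.TTheory GRing.Theory Num.Theory.
Export numFieldNormedType.Exports.

Global Open Scope classical_set_scope.
Global Open Scope complex_scope.
Global Open Scope ring_scope.

Canonical pinfty_filter_on (R : realType) :=
  FilterType (pinfty_nbhs R) (@filter_filter _ _ (@proper_pinfty_nbhs _)).

(* e^{i t} *)
Definition cis (R : realType) (t : R) : R[i] := cos t +i* sin t.

(* Unordered sums of real families.  rsum is meaningful only for absolutely
   summable families; this is always required separately (abs_summable). *)
Definition abs_summable (R : realType) (T : choiceType) (S : set T)
    (F : T -> R) : Prop := summable S (EFin \o F).

Definition rsum (R : realType) (T : choiceType) (S : set T) (F : T -> R) : R :=
  fine (\esum_(x in S) ((EFin \o F)^\+ x) - \esum_(x in S) ((EFin \o F)^\- x))%E.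

Definition csum (R : realType) (T : choiceType) (S : set T)
    (F : T -> R[i]) : R[i] :=
  rsum S (fun x => complex.Re (F x)) +i* rsum S (fun x => complex.Im (F x)).

(* Spinors on T^3 are given by their coefficients on the basis e_a (x) C^2,
   a in Z^3; the Hilbert space of the spectral triple is the set l2. *)
Definition lattice := (int * int * int)%type.

Definition spinor (R : realType) := lattice -> 'cV[R[i]]_2.

Definition sqnorm (R : realType) (v : 'cV[R[i]]_2) : R :=
  \sum_(i < 2) (complex.Re (v i 0) ^+ 2 + complex.Im (v i 0) ^+ 2).

Definition l2 (R : realType) : set (spinor R) :=
  [set psi | abs_summable setT (fun a => sqnorm (psi a))].

Definition norm2 (R : realType) (psi : spinor R) : R :=
  rsum setT (fun a => sqnorm (psi a)).

(* The pair (c, (p, q, r)) is the monomial c U^p V^q W^r, which acts on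
   spinors by e_a |-> c e_{a + (p, q, r)}. *)
Definition monomial (R : realType) := (R[i] * lattice)%type.

Definition mono_op (R : realType) (x : monomial R) (psi : spinor R) : spinor R :=
  fun a => x.1 *: psi (a - x.2).

Definition eU : lattice := (1, 0, 0).
Definition eV : lattice := (0, 1, 0).
Definition eW : lattice := (0, 0, 1).

(* The spin structure of T^3 labelled by eps_j in {0, 1/2} is given by the
   triple of booleans 2 eps_j. *)
Definition spinstr := (bool * bool * bool)%type.

Definition half (R : realType) (b : bool) : R := b%:R / 2.

(* D^3_tau acts on the mode (k, l, m) by Clifford multiplication by
   (x, Re z, Im z), where x = k + eps1 and z = l + eps2 + tau (m + eps3);
   the eigenvalues of this matrix are +- sqrt (x^2 + |z|^2). *)
Definition clifford (R : realType) (x : R) (z : R[i]) : 'M[R[i]]_2 :=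
  \matrix_(i, j)
    if i == 0 then (if j == 0 then x%:C else (z^*)%C)
    else (if j == 0 then z else - x%:C).

Definition dirac_symbol (R : realType) (tau : R[i]) (eps : spinstr)
    (a : lattice) : 'M[R[i]]_2 :=
  let: (e1, e2, e3) := eps in
  let: (k, l, m) := a in
  clifford (k%:~R + half R e1)
    ((l%:~R + half R e2)%:C + tau * (m%:~R + half R e3)%:C).

Definition dirac (R : realType) (tau : R[i]) (eps : spinstr)
    (psi : spinor R) : spinor R :=
  fun a => dirac_symbol tau eps a *m psi a.

Definition dom_dirac (R : realType) (tau : R[i]) (eps : spinstr) :
    set (spinor R) :=
  [set psi | l2 psi /\ l2 (dirac tau eps psi)].

(* Charge conjugation psi |-> (i sigma_2) conj(psi); the mode a has momentum
   a + eps, so that conj(psi) has momentum -a - eps = (-a - 2 eps) + eps. *)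
Definition two_eps (eps : spinstr) : lattice :=
  let: (e1, e2, e3) := eps in ((e1 : nat)%:Z, (e2 : nat)%:Z, (e3 : nat)%:Z).

Definition real_str (R : realType) (eps : spinstr) (psi : spinor R) : spinor R :=
  fun a => let v := psi (- a - two_eps eps) in
    \col_i (if i == 0 then ((v 1 0)^*)%C else - ((v 0 0)^*)%C).

Inductive bieberbach := G2 | G3 | G4 | G5 | G6.

(* 'Z_n is used as a multiplicative finGroupType: its group law is addition. *)
Definition bgroup (M : bieberbach) : finGroupType :=
  match M with
  | G2 => 'Z_2
  | G3 => 'Z_3
  | G4 => 'Z_4
  | G5 => 'Z_6
  | G6 => ('Z_2 * 'Z_2)%type
  end.

(* The generators of G, each with the images of U, V, W under its action. *)
Definition gen_action (R : realType) (M : bieberbach) :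
    seq (bgroup M * (monomial R * monomial R * monomial R)) :=
  match M return seq (bgroup M * (monomial R * monomial R * monomial R)) with
  | G2 => [:: ((1%R : 'Z_2), ((-1, eU), (1, - eV), (1, - eW)))]
  | G3 => [:: ((1%R : 'Z_3),
                ((cis (2 * pi / 3), eU), (1, - eW), (1, - eW + eV)))]
  | G4 => [:: ((1%R : 'Z_4), ((0 +i* 1, eU), (1, eW), (1, - eV)))]
  | G5 => [:: ((1%R : 'Z_6), ((cis (pi / 3), eU), (1, eW), (1, eW - eV)))]
  | G6 => [:: (((1%R, 0%R) : 'Z_2 * 'Z_2),
                ((-1, eU), (1, - eV), (1, - eW)));
              (((0%R, 1%R) : 'Z_2 * 'Z_2),
                ((1, - eU), (-1, eV), (-1, - eW)))]
  end.

(* A spin structure on M = T^3/G over the spin structure eps of T^3: a unitary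
   representation of G on the spinors that implements the action of G on the
   functions and commutes with D^3_tau and with the charge conjugation.
   Without the last condition one would also get the lifts twisted by
   arbitrary characters of G, i.e. Dirac operators coupled to flat lines.
   Such a rho exists only if eps is projectable. *)
Record spin_lift (R : realType) (tau : R[i]) (eps : spinstr) (M : bieberbach)
    (rho : bgroup M -> spinor R -> spinor R) : Prop := SpinLift {
  lift_l2 : forall g psi, l2 psi -> l2 (rho g psi);
  lift_linear : forall g (c : R[i]) psi phi, l2 psi -> l2 phi ->
    rho g (c *: psi + phi) = c *: rho g psi + rho g phi;
  lift_unitary : forall g psi, l2 psi -> norm2 (rho g psi) = norm2 psi;
  lift_one : forall psi, l2 psi -> rho 1%g psi = psi;
  lift_mul : forall g h psi, l2 psi -> rho (g * h)%g psi = rho g (rho h psi);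
  lift_equivariant : forall g u v w, (g, (u, v, w)) \in gen_action R M ->
    forall psi, l2 psi ->
    [/\ rho g (mono_op (1, eU) psi) = mono_op u (rho g psi),
        rho g (mono_op (1, eV) psi) = mono_op v (rho g psi) &
        rho g (mono_op (1, eW) psi) = mono_op w (rho g psi)];
  lift_dirac : forall g psi, dom_dirac tau eps psi ->
    dom_dirac tau eps (rho g psi) /\
    dirac tau eps (rho g psi) = rho g (dirac tau eps psi);
  lift_real : forall g psi, l2 psi ->
    rho g (real_str eps psi) = real_str eps (rho g psi)
}.

Definition invariant_spinors (R : realType) (M : bieberbach)
    (rho : bgroup M -> spinor R -> spinor R) : set (spinor R) :=
  [set psi | l2 psi /\ forall g, rho g psi = psi].

(* The operators considered are the restrictions of D^3_tau to the subspaces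
   H = l2 (the torus) and H = invariant_spinors rho (the quotient).  They are
   self-adjoint with compact resolvent, so that their spectrum is the set of
   their eigenvalues.  An eigenvector in l2 automatically is in the domain. *)
Definition eigenspace_on (R : realType) (tau : R[i]) (eps : spinstr)
    (H : set (spinor R)) (lam : R) : set (spinor R) :=
  [set psi | H psi /\ dirac tau eps psi = lam%:C *: psi].

Definition spectrum (R : realType) (tau : R[i]) (eps : spinstr)
    (H : set (spinor R)) : set R :=
  [set lam | exists2 psi, eigenspace_on tau eps H lam psi & psi != 0].

Definition has_dim (R : realType) (E : set (spinor R)) (n : nat) : Prop :=
  exists b : 'I_n -> spinor R,
    (forall c : 'I_n -> R[i], \sum_i c i *: b i = 0 -> forall i, c i = 0) /\
    E = [set psi | exists c : 'I_n -> R[i], psi = \sum_i c i *: b i].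

Definition multiplicity (R : realType) (tau : R[i]) (eps : spinstr)
    (H : set (spinor R)) (lam : R) : nat :=
  xget 0%N [set n | has_dim (eigenspace_on tau eps H lam) n].

Definition spectral_term (R : realType) (tau : R[i]) (eps : spinstr)
    (H : set (spinor R)) (f : R -> R) (L lam : R) : R :=
  (multiplicity tau eps H lam)%:R * f (lam / L).

Definition spectral_action (R : realType) (tau : R[i]) (eps : spinstr)
    (H : set (spinor R)) (f : R -> R) (L : R) : R :=
  rsum (spectrum tau eps H) (spectral_term tau eps H f L).

Definition spectral_action_converges (R : realType) (tau : R[i])
    (eps : spinstr) (H : set (spinor R)) (f : R -> R) (L : R) : Prop :=
  abs_summable (spectrum tau eps H) (spectral_term tau eps H f L).

(* the integral of f(x) e^{-2 pi i x xi} *)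
Definition fourier (R : realType) (f : R -> R) (xi : R) : R[i] :=
  (\int[lebesgue_measure]_x (f x * cos (2 * pi * x * xi)))%R +i*
  (- \int[lebesgue_measure]_x (f x * sin (2 * pi * x * xi)))%R.

Definition abs_fourier (R : realType) (f : R -> R) (xi : R) : R :=
  Normc.normc (fourier f xi).

(* The Poisson summation formula holds, with absolutely convergent sides, for
   the function f on all the translates x + T Z of all the lattices of R. *)
Definition poisson_applicable (R : realType) (f : R -> R) : Prop :=
  lebesgue_measure.-integrable setT (EFin \o f) /\
  forall T x : R, 0 < T ->
    [/\ abs_summable setT (fun k : int => f (x + k%:~R * T)),
        abs_summable setT (fun n : int => abs_fourier f (n%:~R / T)) &
        (rsum setT (fun k : int => f (x + k%:~R * T)))%:C =
        T^-1%:C * csum setT (fun n : int =>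
          fourier f (n%:~R / T) * cis (2 * pi * n%:~R * x / T))].

(* Main.v *)
(** For [g] in G let t_g(lam) be the trace of the lift of [g] on the
    lam-eigenspace of the torus operator D.  Projecting onto the invariants,
    n mult_M(lam) is the sum of the t_g(lam), and t_1 is the multiplicity on
    the torus.  Let g <> 1.  The lift of [g] commutes with D^2 and with
    translations of modes up to the rotation [g], so its diagonal block at a
    mode vanishes unless the momentum of the mode lies on the axis of [g];
    along the axis the block is multiplied at each step by an n-th root of
    unity w <> 1.  Hence t_g is supported on a coset Z + x0, is n-periodic
    there, and has mean zero over a period.  By Poisson summation the sum of
    f (lam / L) over each class of Z + x0 modulo n is (L / n) hat f (0) up to
    o(1/L), independently of the class, so that the sum of t_g(lam) f (lam / L)
    is o(1/L). *)

(* The lift [rho] is given abstractly, without a formula for its matrices, so the position of its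
   nonzero diagonal blocks has to be extracted from its commutation relations. Every trace is taken
   on a shell D^2 = q, which is spanned by finitely many modes because [tau] is not real. There
   averaging over G and the spectral projection are commuting idempotents, and a dimension becomes
   the trace of their product. Since [f] need not be even, the eigenvalues lam and -lam have to be
   kept apart. On a rotation axis D is a coordinate times a fixed matrix C, and the projections (1 +
   C) / 2 and (1 - C) / 2 act at the two opposite modes of the shell. This yields two geometric
   sequences, with ratios w and w^-1. The error is governed by [f_decay]: the nonzero frequencies of
   a residue class are the multiples of L / n, where the Fourier transform is o(L^-2), and Poisson
   summation multiplies by L / n. *)
Require Import Defs.
From mathcomp Require Import ring lra zify.

Set Implicit Arguments.
Unset Strict Implicit.
Unset Printing Implicit Defensive.

(** * Unordered real sums *)

Section Sums.
Variables (R : realType) (T : choiceType).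
Implicit Types (S : set T) (F G P Q : T -> R).

Lemma abs_summable_le S F G :
  (forall x, S x -> `|F x| <= `|G x|) -> abs_summable S G -> abs_summable S F.
Proof.
by move=> FG; apply: le_lt_trans; apply: le_esum => x Sx; rewrite lee_fin FG.
Qed.

Lemma esum_fin_num S P : (forall x, 0 <= P x) -> abs_summable S P ->
  (\esum_(x in S) (P x)%:E)%E \is a fin_num.
Proof.
move=> P0; rewrite /abs_summable summableE.
by congr (is_true (_ \is a fin_num)); apply: eq_esum => x Sx; rewrite /= ger0_norm ?P0.
Qed.

(** Any decomposition into nonnegative summable families may replace the positive and negative
    parts, which are not additive in [F]. Linearity of [rsum] thus reduces to additivity of
    nonnegative sums. *)
Lemma rsum_posneg S F P Q : abs_summable S P -> abs_summable S Q ->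
  (forall x, 0 <= P x) -> (forall x, 0 <= Q x) ->
  (forall x, S x -> F x = P x - Q x) ->
  rsum S F = fine (\esum_(x in S) (P x)%:E) - fine (\esum_(x in S) (Q x)%:E).
Proof.
move=> sP sQ P0 Q0 FPQ; rewrite -fineB ?esum_fin_num//; congr fine.
have /= <- := esumB sP sQ (fun x _ => P0 x) (fun x _ => Q0 x).
by congr (_ - _)%E; apply: eq_esum => x Sx; rewrite ?funeposE ?funenegE/= FPQ.
Qed.

Lemma eq_rsum S F G : (forall x, S x -> F x = G x) -> rsum S F = rsum S G.
Proof.
move=> FG; rewrite /rsum; congr (fine (_ - _)%E); apply: eq_esum => x Sx;
  by rewrite ?funeposE ?funenegE /= FG.
Qed.

Lemma abs_summable_norm S F : abs_summable S F -> abs_summable S (fun x => `|F x|).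
Proof. by apply: abs_summable_le => x _; rewrite normr_id. Qed.

Lemma abs_summableD S F G :
  abs_summable S F -> abs_summable S G -> abs_summable S (fun x => F x + G x).
Proof. by move=> sF sG; have := summableD sF sG. Qed.

Lemma abs_summableN S F : abs_summable S F -> abs_summable S (fun x => - F x).
Proof. by apply: abs_summable_le => x _ /=; rewrite normrN. Qed.

Lemma le_esumZ S P c : 0 <= c -> (forall x, 0 <= P x) ->
  (\esum_(x in S) (c * P x)%:E <= c%:E * \esum_(x in S) (P x)%:E)%E.
Proof.
move=> c0 P0; apply: ge_ereal_sup => _ [X [finX XS] <-].
under eq_fsbigr do rewrite EFinM.
rewrite -ge0_mule_fsumr => [|x]; last by rewrite lee_fin.
by apply: lee_wpmul2l; rewrite ?lee_fin//; apply: esum_ge; exists X.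
Qed.

Lemma esumZ S P c : 0 <= c -> (forall x, 0 <= P x) ->
  (\esum_(x in S) (c * P x)%:E = c%:E * \esum_(x in S) (P x)%:E)%E.
Proof.
rewrite le_eqVlt => /predU1P[<- P0|c0 P0].
  by rewrite mul0e; apply: esum1 => x _; rewrite mul0r.
apply/eqP; rewrite eq_le le_esumZ ?(ltW c0)//=.
(* The reverse inequality is [le_esumZ] for the factor [c^-1]. *)
rewrite -[leRHS]mul1e -[1%E]/(1%:E) -(mulfV (lt0r_neq0 c0)) EFinM -muleA lee_pmul2l//.
have -> : \esum_(x in S) (P x)%:E = \esum_(x in S) (c^-1 * (c * P x))%:E.
  by apply: eq_esum => x _; rewrite mulKf ?gt_eqF.
by apply: le_esumZ => [|x]; rewrite ?invr_ge0 ?mulr_ge0// ltW.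
Qed.

Lemma abs_summableZ S F c : abs_summable S F -> abs_summable S (fun x => c * F x).
Proof.
rewrite /abs_summable /summable => sF.
have -> : \esum_(x in S) `|(EFin \o (fun x => c * F x)%R) x|%E =
          \esum_(x in S) (`|c| * `|F x|)%:E.
  by apply: eq_esum => x _ /=; rewrite normrM.
rewrite esumZ// lte_mul_pinfty//; exact: sF.
Qed.

Lemma fine_esumD S P Q : (forall x, 0 <= P x) -> (forall x, 0 <= Q x) ->
  abs_summable S P -> abs_summable S Q ->
  fine (\esum_(x in S) (P x + Q x)%:E) =
  fine (\esum_(x in S) (P x)%:E) + fine (\esum_(x in S) (Q x)%:E).
Proof.
move=> P0 Q0 sP sQ; have fP := esum_fin_num P0 sP; have fQ := esum_fin_num Q0 sQ.
rewrite -(fineD fP fQ) -esumD => [//|x _|x _]; by rewrite lee_fin.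
Qed.

Lemma fine_esumZ S P c : 0 <= c -> (forall x, 0 <= P x) -> abs_summable S P ->
  fine (\esum_(x in S) (c * P x)%:E) = c * fine (\esum_(x in S) (P x)%:E).
Proof.
move=> c0 P0 sP; rewrite (esumZ S c0 P0).
by have /fineK <- := esum_fin_num P0 sP.
Qed.

(** The decomposition F = |F| - (|F| - F) serves for all of linearity: adding two of them, or
    scaling one by c >= 0, gives again a decomposition into nonnegative families. *)
Lemma rsumE S F : abs_summable S F ->
  rsum S F = fine (\esum_(x in S) (`|F x|)%:E) -
             fine (\esum_(x in S) (`|F x| - F x)%:E).
Proof.
move=> sF; apply: rsum_posneg => [|||x|x _].
- exact: abs_summable_norm.
- by apply: abs_summableD; [exact: abs_summable_norm|exact: abs_summableN].
- by [].
- by rewrite subr_ge0 ler_norm.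
- by ring.
Qed.

Let sub_ge0 F x : 0 <= `|F x| - F x.
Proof. by rewrite subr_ge0 ler_norm. Qed.

Let summable_sub S F : abs_summable S F -> abs_summable S (fun x => `|F x| - F x).
Proof.
by move=> sF; apply: abs_summableD; [exact: abs_summable_norm|exact: abs_summableN].
Qed.

Lemma rsumD S F G : abs_summable S F -> abs_summable S G ->
  rsum S (fun x => F x + G x) = rsum S F + rsum S G.
Proof.
move=> sF sG.
have nF := abs_summable_norm sF; have nG := abs_summable_norm sG.
have dF := summable_sub sF; have dG := summable_sub sG.
have n0 (H : T -> R) x : 0 <= `|H x| := normr_ge0 _.
rewrite (@rsum_posneg _ _ (fun x => `|F x| + `|G x|)
    (fun x => (`|F x| - F x) + (`|G x| - G x))) => [||||x|x _].
- rewrite (fine_esumD (n0 F) (n0 G) nF nG) (fine_esumD (sub_ge0 F) (sub_ge0 G) dF dG).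
  by rewrite (rsumE sF) (rsumE sG) opprD addrACA.
- exact: abs_summableD nF nG.
- exact: abs_summableD dF dG.
- by move=> x; rewrite addr_ge0.
- exact: addr_ge0 (sub_ge0 F x) (sub_ge0 G x).
- by rewrite addrACA -!addrA; ring.
Qed.

Lemma rsumN S F : abs_summable S F -> rsum S (fun x => - F x) = - rsum S F.
Proof.
move=> sF; rewrite (@rsum_posneg _ _ (fun x => `|F x| - F x) (fun x => `|F x|)) //.
- by rewrite rsumE// opprB.
- exact: summable_sub.
- exact: abs_summable_norm.
- by move=> x _; ring.
Qed.

Lemma rsumZ S F c : abs_summable S F -> rsum S (fun x => c * F x) = c * rsum S F.
Proof.
wlog c0 : c / 0 <= c => [hw|] sF.
  have [/hw->//|/ltW c0] := leP 0 c.
  rewrite -[c]opprK; under eq_rsum do rewrite mulNr.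
  by rewrite rsumN ?hw ?oppr_ge0// ?mulNr//; exact: abs_summableZ.
have nF := abs_summable_norm sF; have dF := summable_sub sF.
have n0 x : 0 <= `|F x| := normr_ge0 _.
rewrite (@rsum_posneg _ _ (fun x => c * `|F x|)
    (fun x => c * (`|F x| - F x))) => [||||x|x _].
- by rewrite (fine_esumZ c0 n0 nF) (fine_esumZ c0 (sub_ge0 F) dF) (rsumE sF) mulrBr.
- exact: abs_summableZ nF.
- exact: abs_summableZ dF.
- by move=> x; rewrite mulr_ge0.
- exact: mulr_ge0 c0 (sub_ge0 F x).
- by ring.
Qed.

Lemma rsum0 S F : (forall x, S x -> F x = 0) -> rsum S F = 0.
Proof.
move=> F0; rewrite /rsum !esum1 ?subee//= => x Sx.
  by rewrite funenegE /= F0// oppr0 maxxx.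
by rewrite funeposE /= F0// maxxx.
Qed.

Lemma abs_summable0 S F : (forall x, S x -> F x = 0) -> abs_summable S F.
Proof.
by move=> F0; rewrite /abs_summable /summable esum1// => x /F0 /= ->; rewrite normr0.
Qed.

Lemma abs_summable_sum (I : Type) (r : seq I) (A : pred I) S (F : I -> T -> R) :
  (forall i, A i -> abs_summable S (F i)) ->
  abs_summable S (fun x => \sum_(i <- r | A i) F i x).
Proof.
move=> sF; elim: r => [|i r IH].
  by apply: abs_summable0 => x _; rewrite big_nil.
have [Ai|nAi] := boolP (A i).
  apply: (abs_summable_le (G := fun x => F i x + \sum_(i <- r | A i) F i x)).
    by move=> x _; rewrite big_cons Ai.
  by apply: abs_summableD => //; exact: sF.
by apply: abs_summable_le IH => x _; rewrite big_cons (negbTE nAi).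
Qed.

Lemma rsum_sum (I : Type) (r : seq I) (A : pred I) S (F : I -> T -> R) :
  (forall i, A i -> abs_summable S (F i)) ->
  rsum S (fun x => \sum_(i <- r | A i) F i x) = \sum_(i <- r | A i) rsum S (F i).
Proof.
move=> sF; elim: r => [|i r IH].
  by rewrite big_nil rsum0// => x _; rewrite big_nil.
rewrite big_cons; under eq_rsum do rewrite big_cons.
by case: ifP => // Ai; rewrite rsumD ?IH//; [exact: sF|exact: abs_summable_sum].
Qed.

Lemma le_norm_rsum S F G : (forall x, S x -> `|F x| <= G x) -> abs_summable S G ->
  `|rsum S F| <= rsum S G.
Proof.
move=> FG sG.
have sF : abs_summable S F.
  by apply: abs_summable_le sG => x Sx; rewrite (le_trans (FG x Sx))// ler_norm.
have pos (H : T -> R) : abs_summable S H -> (forall x, S x -> 0 <= H x) -> 0 <= rsum S H.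
  move=> sH H0; have z0 := @abs_summable0 S (fun=> 0) (fun x _ => erefl).
  rewrite (rsum_posneg (F := H) (abs_summable_norm sH) z0) => [|x|x|x Sx]; last first.
  - by rewrite subr0 ger0_norm ?H0.
  - by [].
  - exact: normr_ge0.
  - rewrite [X in _ - fine X]esum1// subr0; apply: fine_ge0.
    by apply: esum_ge0 => x _; rewrite lee_fin.
have sNF := abs_summableN sF.
rewrite ler_norml; apply/andP; split.
  have := pos _ (abs_summableD sG sF); rewrite (rsumD sG sF) => h.
  suff : 0 <= rsum S G + rsum S F by lra.
  by apply: h => x /FG; rewrite ler_norml => /andP[]; lra.
have := pos _ (abs_summableD sG sNF); rewrite (rsumD sG sNF) (rsumN sF) => h.
suff : 0 <= rsum S G - rsum S F by lra.
by apply: h => x /FG; rewrite ler_norml => /andP[]; lra.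
Qed.

Lemma abs_summable_supp S F : (forall x, ~ S x -> F x = 0) ->
  abs_summable S F -> abs_summable setT F.
Proof.
move=> F0; rewrite /abs_summable /summable (esum_mkcond S); apply: le_lt_trans.
apply: le_esum => x _; case: ifPn => //; rewrite notin_setE => /F0 /= ->.
by rewrite normr0.
Qed.

Lemma rsum_supp S F : (forall x, ~ S x -> F x = 0) -> rsum S F = rsum setT F.
Proof.
move=> F0; rewrite /rsum (esum_mkcond S) [X in (_ - X)%E](esum_mkcond S).
by congr (fine (_ - _)%E); apply: eq_esum => x _; case: ifPn => //;
  rewrite notin_setE => /F0; rewrite ?funeposE ?funenegE /= => ->; rewrite ?oppr0 maxxx.
Qed.

Lemma rsum_set1 (t : T) F : rsum [set t] F = F t.
Proof.
have sF : abs_summable [set t] F.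
  by rewrite /abs_summable /summable esum_set1 ?abse_ge0//= ltry.
rewrite (rsumE sF) !esum_set1 ?lee_fin ?subr_ge0 ?ler_norm//=.
by rewrite subKr.
Qed.

Lemma abs_summable_cover (A B : set T) F : (forall x, A x \/ B x) ->
  abs_summable A F -> abs_summable B F -> abs_summable setT F.
Proof.
move=> AB sA sB.
have patch (C : set T) : abs_summable C F ->
    abs_summable setT (fun x => `|if x \in C then F x else 0|).
  move=> sC; apply: abs_summable_norm; apply: (abs_summable_supp (S := C)).
    by move=> x nCx; rewrite memNset.
  by apply: abs_summable_le sC => x Cx; rewrite mem_set.
apply: abs_summable_le (abs_summableD (patch A sA) (patch B sB)) => x _.
rewrite [leRHS]ger0_norm ?addr_ge0//.
by have [Ax|Bx] := AB x; [rewrite (mem_set Ax) lerDl|rewrite (mem_set Bx) lerDr].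
Qed.

End Sums.

Section Reindex.
Variables (R : realType) (T T' : choiceType).

Lemma abs_summable_image (P : set T) (e : T -> T') (F : T' -> R) : set_inj P e ->
  abs_summable (e @` P) F <-> abs_summable P (F \o e).
Proof. by move=> ie; rewrite /abs_summable /summable esum_image. Qed.

Lemma rsum_image (P : set T) (e : T -> T') (F : T' -> R) : set_inj P e ->
  rsum (e @` P) F = rsum P (F \o e).
Proof.
move=> ie; rewrite /rsum !esum_image//.
by congr (fine (_ - _)%E); apply: eq_esum => x _; rewrite ?funeposE ?funenegE.
Qed.

End Reindex.

(** * Poisson summation over a residue class *)

Section PoissonSummation.
Variable R : realType.

Lemma sum_inv_sqr_le n : \sum_(0 <= i < n) (i.+1%:R ^- 2 : R) <= 2.
Proof.
(* The bound is strengthened by the telescoping term 1 / x with x = n + 1; the induction step then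
   has the slack 1 / (x (x + 1)^2). *)
suff h : \sum_(0 <= i < n.+1) (i.+1%:R ^- 2 : R) <= 2 - n.+1%:R^-1.
  case: n h => [|n] h; first by rewrite big_nil.
  apply: (le_trans _ (le_trans h _)); last by rewrite gerBl.
  by rewrite [leRHS]big_nat_recr//= lerDl invr_ge0 exprn_ge0.
elim: n => [|n IH]; first by rewrite big_nat1 expr1n invr1; lra.
rewrite big_nat_recr//=; apply: (le_trans (lerD IH (lexx _))).
have n0 : 0 < n.+1%:R :> R by [].
rewrite -[n.+2]addn1 natrD; set x := n.+1%:R : R in n0 *.
rewrite -subr_ge0.
have -> : 2 - (x + 1)^-1 - (2 - x^-1 + (x + 1) ^- 2) = (x * (x + 1) ^+ 2)^-1.
  by field; rewrite !lt0r_neq0//; lra.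
by rewrite invr_ge0 mulr_ge0 ?sqr_ge0// ltW.
Qed.

(** The index 0 contributes 0 by the convention [0^-1 = 0], so that this family can majorise a
    Fourier series whose zero frequency has been removed. *)
Lemma abs_summable_inv_sqr : abs_summable setT (fun n : int => (n%:~R : R) ^- 2).
Proof.
rewrite /abs_summable /summable.
have nat_bound : (\esum_(n in [set: nat]) (n.+1%:R ^- 2 : R)%:E <= 2%:E)%E.
  rewrite -nneseries_esumT => [|n]; last by rewrite lee_fin invr_ge0 exprn_ge0.
  apply: lime_le.
    by apply: is_cvg_nneseries => n _ _; rewrite lee_fin invr_ge0 exprn_ge0.
  by apply: nearW => n; rewrite sumEFin lee_fin sum_inv_sqr_le.
have fin2 : (2%:E < +oo :> \bar R)%E by rewrite ltry.
have sS : abs_summable setT (fun n : nat => (n.+1%:R : R) ^- 2).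
  apply: le_lt_trans (le_lt_trans nat_bound fin2); apply: le_esum => n _ /=.
  by rewrite lee_fin ger0_norm ?invr_ge0 ?exprn_ge0.
apply: (@abs_summable_cover _ _ (Posz @` setT) (Negz @` setT)).
- by move=> [n|n]; [left|right]; exists n.
- apply/abs_summable_image; first by move=> x y _ _ [].
  apply: (@abs_summable_cover _ _ [set 0%N] (succn @` setT)).
  + by move=> [|n]; [left|right; exists n].
  + by rewrite /abs_summable /summable esum_set1 ?abse_ge0//= ltry.
  + by apply/abs_summable_image => // x y _ _ [].
- apply/abs_summable_image; first by move=> x y _ _ [].
  by apply: abs_summable_le sS => n _ /=; rewrite NegzE mulrNz sqrrN.
Qed.

Lemma Re_le_normc (z : R[i]) : `|complex.Re z| <= Normc.normc z.
Proof. by case: z => a b /=; rewrite -sqrtr_sqr ler_wsqrtr// lerDl sqr_ge0. Qed.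

Lemma normc_cis (t : R) : Normc.normc (cis t) = 1.
Proof. by rewrite /= cos2Dsin2 sqrtr1. Qed.

Lemma Re_mul_cis_le (z : R[i]) t : `|complex.Re (z * cis t)| <= Normc.normc z.
Proof. by apply: le_trans (Re_le_normc _) _; rewrite Normc.normcM normc_cis mulr1. Qed.

Section Poisson.
Variable f : R -> R.
Hypothesis f_poisson : poisson_applicable f.

(** As [f] is real, the transform at -xi is the conjugate of that at xi. This carries the decay,
    which is assumed at +oo only, over to negative frequencies. *)
Lemma abs_fourierN xi : abs_fourier f (- xi) = abs_fourier f xi.
Proof.
have [fi _] := f_poisson.
rewrite /abs_fourier /fourier /=; congr (Num.sqrt (_ + _)).
  congr (_ ^+ 2); apply: eq_Rintegral => x _.
  by rewrite mulrN cosN.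
rewrite !sqrrN.
have -> : \int[lebesgue_measure]_x (f x * sin (2 * pi * x * - xi)) =
   \int[lebesgue_measure]_x (-1 * (f x * sin (2 * pi * x * xi))).
  by apply: eq_Rintegral => x _; rewrite mulrN sinN; ring.
rewrite RintegralZl ?mulN1r ?sqrrN//.
have -> : EFin \o (fun x => f x * sin (2 * pi * x * xi)) =
  ((EFin \o f) \* (EFin \o (fun x => sin (2 * pi * x * xi))))%E by [].
apply: integrableMl => //; last first.
  exists 1; split => // M M1 x _ /=; rewrite (le_trans _ (ltW M1))//.
  by rewrite ler_norml sin_geN1 sin_le1.
apply: measurable_realfun.continuous_measurable_fun => x.
apply: (@continuous_comp _ _ _ (fun x => 2 * pi * x * xi) sin); last exact: continuous_sin.
by apply: cvgMr_tmp; apply: cvgMl_tmp; exact: cvg_id.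
Qed.

(** For the spacing T = n / L the zero frequency gives the main term. The frequency k / T
    contributes o(T^2 / k^2), and the prefactor 1 / T leaves o(T) = o(1 / L). The threshold must not
    depend on [x], because the residue classes will be started at points that move with [L]. *)
Lemma poisson_estimate (n : nat) (e : R) : (0 < n)%N -> 0 < e ->
  abs_fourier f =o_+oo (fun xi : R => xi ^- 2) ->
  exists2 K : R, 0 < K & forall L x : R, K <= L ->
    `|rsum setT (fun k : int => f (x + k%:~R * (n%:R / L)))
       - L / n%:R * complex.Re (fourier f 0)| <= e / L.
Proof.
move=> n0 e0 /eqoP fo; have fN := abs_fourierN; have sI := abs_summable_inv_sqr.
have n0R : 0 < n%:R :> R by rewrite ltr0n.
pose C := rsum setT (fun n : int => (n%:~R : R) ^- 2).
have C0 : 0 <= C.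
  rewrite (le_trans (normr_ge0 C))// le_norm_rsum// => k _.
  by rewrite ger0_norm// invr_ge0 sqr_ge0.
(* This tolerance turns the final bound (L / n) d T^2 C into (e / L) C / (C + 1); [C + 1] is
   manifestly positive, while [C] is only known to be nonnegative. *)
have d0 : 0 < e / (n%:R * (C + 1)) by rewrite divr_gt0// mulr_gt0// ltr_wpDl.
have [K [_ hK]] := fo _ d0.
set d := e / _ in d0 hK.
(* With this threshold the smallest nonzero frequency L / n already lies beyond [K], where the decay
   estimate holds. *)
exists (n%:R * (`|K| + 1)); first by rewrite mulr_gt0// ltr_wpDl.
move=> L x KL.
have L0 : 0 < L by apply: lt_le_trans KL; rewrite mulr_gt0// ltr_wpDl.
have T0 : 0 < n%:R / L by rewrite divr_gt0.
have KL' : K < (n%:R / L)^-1.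
  rewrite invf_div ltr_pdivlMr// mulrC (lt_le_trans _ KL)// ltr_pM2l//.
  by rewrite (le_lt_trans (ler_norm K))// ltrDl.
set T := n%:R / L in T0 KL' *.
have [_ /(_ T x T0)[sf sF]] := f_poisson.
move=> /(congr1 (@complex.Re R)) /=; rewrite mul0r subr0 => ->.
pose G (k : int) := complex.Re (fourier f (k%:~R / T) * cis (2 * pi * k%:~R * x / T)).
have sG : abs_summable setT G.
  by apply: abs_summable_le sF => k _; rewrite (le_trans (Re_mul_cis_le _ _))// ler_norm.
pose G0 (k : int) := if k == 0 then G k else 0.
have G00 k : ~ [set 0] k -> G0 k = 0 by move=> /eqP/negbTE; rewrite /G0 => ->.
have sG0 : abs_summable setT G0.
  by apply: abs_summable_le sG => k _; rewrite /G0; case: ifP => //; rewrite normr0.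
have sGG : abs_summable setT (fun k => G k - G0 k).
  by apply: abs_summableD => //; exact: abs_summableN.
have -> : rsum setT G = complex.Re (fourier f 0) + rsum setT (fun k => G k - G0 k).
  rewrite -[in LHS](_ : (fun k => G0 k + (G k - G0 k)) = G).
    rewrite rsumD// -(rsum_supp G00) rsum_set1 /G0 eqxx /G !mul0r mulr0 !mul0r.
    by rewrite /cis cos0 sin0 mulr1.
  by apply/funext => k; ring.
rewrite mulrDr [T^-1]invf_div addrAC subrr add0r normrM gtr0_norm ?divr_gt0//.
have bd k : `|G k - G0 k| <= d * T ^+ 2 * (k%:~R : R) ^- 2.
  rewrite /G0; have [->|k0] := eqVneq k 0.
    by rewrite subrr normr0 expr0n/= invr0 mulr0.
  rewrite subr0 (le_trans (Re_mul_cis_le _ _))// -/(abs_fourier f _).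
  have kT : K < `|k%:~R / T|.
    rewrite normrM (gtr0_norm (x := T^-1)) ?invr_gt0// (lt_le_trans KL')//.
    rewrite ler_peMl ?invr_ge0 ?(ltW T0)// -intr_norm ler1z.
    by rewrite -gtz0_ge1 normr_gt0.
  have -> : abs_fourier f (k%:~R / T) = abs_fourier f `|k%:~R / T|.
    by have [h|h] := leP 0 (k%:~R / T); [rewrite ger0_norm|rewrite ltr0_norm ?fN].
  have u2 : `|k%:~R / T| ^+ 2 = (k%:~R / T) ^+ 2 by rewrite -normrX ger0_norm ?sqr_ge0.
  apply: le_trans (ler_norm _) (le_trans (hK _ kT) _).
  by rewrite u2 ger0_norm ?invr_ge0 ?sqr_ge0// expr_div_n invf_div mulrA.
apply: (le_trans (ler_wpM2l _ (le_norm_rsum (fun k _ => bd k) _))).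
- by rewrite divr_ge0// ltW.
- exact: abs_summableZ.
rewrite rsumZ// -/C.
have -> : L / n%:R * (d * T ^+ 2 * C) = (d * n%:R * C) / L.
  by rewrite /T; field; rewrite !lt0r_neq0.
rewrite ler_pM2r ?invr_gt0// /d.
have -> : e / (n%:R * (C + 1)) * n%:R * C = e * (C / (C + 1)).
  by field; rewrite !lt0r_neq0// ltr_wpDl.
by rewrite ger_pMr// ler_pdivrMr ?ltr_wpDl// mul1r lerDl.
Qed.

End Poisson.
End PoissonSummation.

(** * Sums of f against periodic weights of mean zero *)

Section PeriodicSums.
Variables (R : realType) (f : R -> R).
Hypothesis f_poisson : poisson_applicable f.
Hypothesis f_decay : abs_fourier f =o_+oo (fun xi : R => xi ^- 2).

Section Residues.
Variables (n : nat) (n0 : (0 < n)%N) (d : int -> R).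
Hypothesis d_periodic : forall k, d (k + n%:Z) = d k.

Lemma periodicM k j : d (k + j * n%:Z) = d k.
Proof.
have natM m : forall l, d (l + m%:Z * n%:Z) = d l.
  elim: m => [|m IH] l; first by rewrite mul0r addr0.
  by rewrite -[m.+1]addn1 PoszD mulrDl mul1r addrA d_periodic IH.
case: j => m; first exact: natM.
by rewrite NegzE mulNr -(natM m.+1 (k - _)) subrK.
Qed.

Lemma rsum_residues (F : int -> R) :
  (forall r : 'I_n, abs_summable setT (fun j : int => F (r%:Z + j * n%:Z))) ->
  abs_summable setT F /\
  rsum setT F = \sum_(r < n) rsum setT (fun j : int => F (r%:Z + j * n%:Z)).
Proof.
move=> sF; have nZ : n%:Z != 0 by have := n0; lia.
pose S (r : 'I_n) : set int := (fun j : int => r%:Z + j * n%:Z) @` setT.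
have inj (r : 'I_n) : set_inj setT (fun j : int => r%:Z + j * n%:Z).
  by move=> i j _ _ /addrI /(mulIf nZ).
pose G (r : 'I_n) k := if (k %% n%:Z)%Z == r%:Z then F k else 0.
have GS (r : 'I_n) k : ~ S r k -> G r k = 0.
  rewrite /G; case: eqP => // kr nS; case: nS.
  by exists (k %/ n%:Z)%Z => //; rewrite -kr addrC -divz_eq.
have GF (r : 'I_n) j : G r (r%:Z + j * n%:Z) = F (r%:Z + j * n%:Z).
  by rewrite /G addrC modzMDl modz_small ?eqxx//; have := ltn_ord r; lia.
have FG : (fun k => \sum_(r < n) G r k) = F.
  apply/funext => k; have kn : (`|(k %% n%:Z)%Z| < n)%N.
    by have := modz_ge0 k nZ; have := ltz_pmod k (d := n%:Z); lia.
  rewrite (bigD1 (Ordinal kn))//= big1 => [|r rk].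
    by rewrite addr0 /G/= gez0_abs ?eqxx ?modz_ge0.
  rewrite /G; case: eqP => // kr; case/eqP: rk; apply/val_inj => /=.
  by rewrite kr.
have sG (r : 'I_n) : abs_summable setT (G r).
  apply: (abs_summable_supp (GS r)); apply/abs_summable_image; first exact: inj.
  by apply: abs_summable_le (sF r) => j _; rewrite /= GF.
split; first by rewrite -FG; apply: abs_summable_sum => r _; exact: sG.
rewrite -[in LHS]FG rsum_sum => [|r _]; last exact: sG.
apply: eq_bigr => r _; rewrite -(rsum_supp (GS r)) rsum_image; last exact: inj.
by apply: eq_rsum => j _; rewrite /= GF.
Qed.

Variable x0 : R.

Let term (L : R) (k : int) := d k * f ((k%:~R + x0) / L).

Let termE L (r : 'I_n) : (fun j : int => term L (r%:Z + j * n%:Z)) =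
  (fun j : int => d r%:Z * f ((r%:R + x0) / L + j%:~R * (n%:R / L))).
Proof.
apply/funext => j; rewrite /term periodicM; congr (_ * f _).
by rewrite rmorphD rmorphM/= -!pmulrn; ring.
Qed.

Let summable_term L : 0 < L -> forall r : 'I_n,
  abs_summable setT (fun j : int => term L (r%:Z + j * n%:Z)).
Proof.
move=> L0 r; rewrite termE; apply: abs_summableZ.
have T0 : 0 < n%:R / L by rewrite divr_gt0// ltr0n.
by have [_ /(_ _ ((r%:R + x0) / L) T0)[]] := f_poisson.
Qed.

Lemma abs_summable_periodic L : 0 < L ->
  abs_summable setT (fun k : int => d k * f ((k%:~R + x0) / L)).
Proof. by move=> /summable_term /rsum_residues[]. Qed.

Lemma rsum_periodic_le (e : R) : \sum_(r < n) d r%:Z = 0 -> 0 < e ->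
  exists2 K : R, 0 < K & forall L : R, K <= L ->
    `|rsum setT (fun k : int => d k * f ((k%:~R + x0) / L))| <= e / L.
Proof.
move=> d_mean e0; pose D := \sum_(r < n) `|d r%:Z|.
have D0 : 0 < D + 1 by rewrite ltr_wpDl// sumr_ge0.
have [K K0 hK] := poisson_estimate f_poisson n0 (divr_gt0 e0 D0) f_decay.
exists K => // L KL; have L0 := lt_le_trans K0 KL.
have [_ ->] := rsum_residues (summable_term L0).
have T0 : 0 < n%:R / L by rewrite divr_gt0// ltr0n.
(* Because [d] sums to zero over a period, [A] can be subtracted from every class sum at no cost. *)
pose A := L / n%:R * complex.Re (fourier f 0).
have -> : \sum_(r < n) rsum setT (fun j : int => term L (r%:Z + j * n%:Z)) =
  \sum_(r < n) d r%:Z *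
     (rsum setT (fun k : int => f ((r%:R + x0) / L + k%:~R * (n%:R / L))) - A).
  under [RHS]eq_bigr do rewrite mulrBr.
  rewrite sumrB -mulr_suml d_mean mul0r subr0; apply: eq_bigr => r _.
  rewrite termE rsumZ//.
  by have [_ /(_ _ ((r%:R + x0) / L) T0)[]] := f_poisson.
apply: (le_trans (ler_norm_sum _ _ _)).
have -> : e / L = (D + 1) * (e / (D + 1) / L) by field; rewrite !lt0r_neq0.
apply: (@le_trans _ _ (D * (e / (D + 1) / L))).
  rewrite /D mulr_suml; apply: ler_sum => r _.
  by rewrite normrM ler_wpM2l// hK.
by rewrite ler_wpM2r ?lerDl// !divr_ge0// ltW.
Qed.

End Residues.

(** A weight on the whole real line rather than a sequence: the offset [x0] may vary with the group
    element, yet all the sums then share one index set. The zero weight is included, for rotations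
    whose axis carries no mode. *)
Definition oscillating (n : nat) (h : R -> R) := exists x0 : R,
  [/\ forall k : int, h ((k + n%:Z)%:~R + x0) = h (k%:~R + x0),
      \sum_(r < n) h (r%:R + x0) = 0 &
      forall x, (forall k : int, x <> k%:~R + x0) -> h x = 0].

Lemma oscillating_summable n h L : (0 < n)%N -> oscillating n h -> 0 < L ->
  abs_summable setT (fun x => h x * f (x / L)).
Proof.
move=> n0 [x0 [per _ supp]] L0.
apply: (abs_summable_supp (S := (fun k : int => k%:~R + x0) @` setT)).
  by move=> x nx; rewrite supp ?mul0r// => k xk; apply: nx; exists k.
apply/abs_summable_image; first by move=> i j _ _ /addIr /intr_inj.
exact: (abs_summable_periodic n0 per x0 L0).
Qed.

Lemma oscillating_rsum_le n h e : (0 < n)%N -> oscillating n h -> 0 < e ->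
  exists2 K : R, 0 < K & forall L : R, K <= L ->
    `|rsum setT (fun x => h x * f (x / L))| <= e / L.
Proof.
move=> n0 [x0 [per mean supp]] e0.
have mean' : \sum_(r < n) h ((r%:Z)%:~R + x0) = 0.
  by rewrite -[RHS]mean; apply: eq_bigr => r _; rewrite -pmulrn.
have [K K0 hK] := rsum_periodic_le n0 per x0 mean' e0.
exists K => // L /hK; rewrite -(rsum_supp (S := (fun k : int => k%:~R + x0) @` setT)).
  by rewrite rsum_image//; move=> i j _ _ /addIr /intr_inj.
by move=> x nx; rewrite supp ?mul0r// => k xk; apply: nx; exists k.
Qed.

End PeriodicSums.

(** * Multiplicities as traces *)

(** In a full-rank factorisation Q = A B, idempotence gives B A = 1 after cancelling A on the left
    and B on the right, and tr (A B) = tr (B A). *)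
Lemma idempotent_rank_trace (F : fieldType) n (Q : 'M[F]_n) :
  Q *m Q = Q -> (\rank Q)%:R = \tr Q.
Proof.
suff tr_factor r (A : 'M[F]_(n, r)) (B : 'M[F]_(r, n)) :
    row_full A -> row_free B -> Q = A *m B -> Q *m Q = Q -> r%:R = \tr Q.
  by apply: (tr_factor _ (col_base Q) (row_base Q));
    rewrite ?col_base_full ?row_base_free ?mulmx_base.
move=> /row_fullP[A' A'A] /row_freeP[B' BB'] -> QQ.
rewrite mxtrace_mulC (_ : B *m A = 1%:M) ?mxtrace1//.
have : A' *m (A *m B *m (A *m B)) *m B' = A' *m (A *m B) *m B' by rewrite QQ.
by rewrite -!mulmxA BB' mulmx1 (mulmxA A' A) A'A !mul1mx.
Qed.

(** * Dimension of the range of an idempotent on finitely many modes *)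

Section Dimension.
Variable R : realType.
Implicit Types (E : set (spinor R)).

Lemma has_dim_le E m n : has_dim E m -> has_dim E n -> (n <= m)%N.
Proof.
move=> [b [_ Eb]] [b' [free' Eb']].
have /(_ _)/cid-/all_sig[A bA] : forall j, exists c : 'I_m -> R[i], b' j = \sum_i c i *: b i.
  move=> j; have : E (b' j).
    rewrite Eb'; exists (fun i => (i == j)%:R).
    rewrite (bigD1 j)//= eqxx scale1r big1 ?addr0// => i /negbTE ->.
    by rewrite scale0r.
  by rewrite Eb.
pose M := \matrix_(j < n, i < m) A j i.
suff : row_free M by rewrite /row_free => /eqP <-; exact: rank_leq_col.
apply: inj_row_free => v vM; apply/rowP => j; rewrite mxE.
apply: (free' (fun j => v 0 j)).
transitivity (\sum_i (v *m M) 0 i *: b i).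
  under eq_bigr do rewrite bA scaler_sumr.
  rewrite exchange_big/=; apply: eq_bigr => i _.
  rewrite mxE scaler_suml; apply: eq_bigr => k _.
  by rewrite !mxE scalerA.
by rewrite vM big1// => i _; rewrite mxE scale0r.
Qed.

Lemma multiplicity_has_dim (tau : R[i]) eps (H : set (spinor R)) lam n :
  has_dim (eigenspace_on tau eps H lam) n -> multiplicity tau eps H lam = n.
Proof.
move=> En; rewrite /multiplicity; case: xgetP => [m _ Em|/(_ n)//].
by apply/eqP; rewrite eqn_leq (has_dim_le En Em) (has_dim_le Em En).
Qed.

(** The standard basis vector e_a (x) e_i. *)
Definition delta_spinor (a : lattice) (i : 'I_2) : spinor R :=
  fun b => if b == a then delta_mx i 0 else 0.

Definition supp_in (s : seq lattice) (psi : spinor R) :=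
  forall a, a \notin s -> psi a = 0.

Section IdempotentRange.
Variables (s : seq lattice) (s_uniq : uniq s) (P : spinor R -> spinor R).
Hypothesis P_supp : forall psi, supp_in s psi -> supp_in s (P psi).
Hypothesis P_linear : forall (c : R[i]) psi phi, supp_in s psi -> supp_in s phi ->
  P (c *: psi + phi) = c *: P psi + P phi.
Hypothesis P_idem : forall psi, supp_in s psi -> P (P psi) = P psi.

Let I : finType := ('I_(size s) * 'I_2)%type.
Let pt (x : I) : lattice := tnth (in_tuple s) x.1.
Let b (x : I) := delta_spinor (pt x) x.2.
Let coef (x : I) (psi : spinor R) : R[i] := psi (pt x) x.2 0.

Let pt_inj (x y : I) : pt x = pt y -> x.1 = y.1.
Proof. by have /tuple_uniqP := (s_uniq : uniq (in_tuple s)); apply. Qed.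

Let coef_b x y : coef y (b x) = (x == y)%:R.
Proof.
rewrite /coef /b /delta_spinor; case: x y => [i j] [i' j'] /=.
case: eqP => [e|ne].
  by have /= -> := pt_inj e; rewrite mxE eqxx andbT xpair_eqE eqxx/= eq_sym.
rewrite mxE xpair_eqE; case: eqP => //= ii; case: ne; by rewrite /pt /= ii.
Qed.

Let coef_sum (c : I -> R[i]) y : coef y (\sum_x c x *: b x) = c y.
Proof.
rewrite /coef fct_sumE summxE (bigD1 y)//= big1 ?addr0.
  by rewrite mxE -/(coef y (b y)) coef_b eqxx mulr1.
by move=> x xy; rewrite mxE -/(coef y (b x)) coef_b (negbTE xy) mulr0.
Qed.

Let supp_b x : supp_in s (b x).
Proof.
move=> a; rewrite /b /delta_spinor; case: eqP => // ->.
by rewrite /pt mem_tnth.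
Qed.

Let supp_sum (c : I -> R[i]) : supp_in s (\sum_x c x *: b x).
Proof.
move=> a sa; rewrite fct_sumE big1// => x _.
by transitivity (c x *: b x a); [|rewrite supp_b// scaler0].
Qed.

Let expand psi : supp_in s psi -> psi = \sum_x coef x psi *: b x.
Proof.
move=> spsi; apply/funext => a; have [|sa] := boolP (a \in s); last first.
  by rewrite supp_sum ?spsi.
move=> /(tnthP (in_tuple s))[k ->]; apply/colP => j.
by rewrite -[RHS]/(coef (k, j) _) coef_sum.
Qed.

Let P0 : P 0 = 0.
Proof.
have s0 : supp_in s 0 by [].
have := P_linear 1 s0 s0; rewrite !scale1r addr0 => e.
by apply: (addrI (P 0)); rewrite addr0 -e.
Qed.

Let P_sum (c : I -> R[i]) : P (\sum_x c x *: b x) = \sum_x c x *: P (b x).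
Proof.
suff : forall r : seq I, P (\sum_(x <- r) c x *: b x) = \sum_(x <- r) c x *: P (b x).
  by move=> /(_ (index_enum I)).
elim=> [|x r IH]; first by rewrite !big_nil P0.
rewrite !big_cons P_linear ?IH//.
move=> a sa; rewrite fct_sumE big1// => y _.
by transitivity (c y *: b y a); [|rewrite supp_b// scaler0].
Qed.

Let Q : 'M[R[i]]_#|I| := \matrix_(i, j) coef (enum_val j) (P (b (enum_val i))).
Let Phi (c : 'rV[R[i]]_#|I|) : spinor R := \sum_i c 0 i *: b (enum_val i).

Let PhiE c : Phi c = \sum_x c 0 (enum_rank x) *: b x.
Proof.
rewrite /Phi (reindex enum_rank); last by apply: onW_bij; exact: enum_rank_bij.
by apply: eq_bigr => x _; rewrite enum_rankK.
Qed.

Let coef_Phi c i : coef (enum_val i) (Phi c) = c 0 i.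
Proof. by rewrite PhiE coef_sum enum_valK. Qed.

Let P_Phi c : P (Phi c) = Phi (c *m Q).
Proof.
rewrite [RHS]PhiE [Phi c]PhiE P_sum.
under eq_bigr => x _ do rewrite (expand (P_supp (@supp_b x))) scaler_sumr.
rewrite exchange_big/=; apply: eq_bigr => y _.
rewrite mxE scaler_suml [RHS](reindex enum_rank)/=; last first.
  by apply: onW_bij; exact: enum_rank_bij.
by apply: eq_bigr => x _; rewrite mxE !enum_rankK scalerA.
Qed.

Let Phi_inj c c' : Phi c = Phi c' -> c = c'.
Proof. by move=> cc; apply/rowP => i; rewrite -!coef_Phi cc. Qed.

Let supp_Phi c : supp_in s (Phi c).
Proof. by rewrite PhiE; exact: supp_sum. Qed.

(** In the basis of delta spinors over [s], [P] becomes an idempotent matrix, whose rank is its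
    trace. Everything is asked on spinors supported in [s] only, since the operators to be used are
    idempotent only on one shell. *)
Lemma has_dim_idempotent E : E = [set psi | supp_in s psi /\ P psi = psi] ->
  exists2 r, has_dim E r &
    r%:R = \sum_(a <- s) \sum_i P (delta_spinor a i) a i 0.
Proof.
move=> ->; have QQ : Q *m Q = Q.
  apply/row_matrixP => i; rewrite !rowE; apply: Phi_inj.
  by rewrite mulmxA -!P_Phi P_idem.
exists (\rank Q); last first.
  rewrite idempotent_rank_trace// /mxtrace (reindex enum_rank)/=; last first.
    by apply: onW_bij; exact: enum_rank_bij.
  rewrite (big_tnth _ _ s) pair_big/=; apply: eq_bigr => x _.
  by rewrite mxE !enum_rankK.
have PhiD m (c : 'I_m -> R[i]) (v : 'M[R[i]]_(m, #|I|)) :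
    \sum_i c i *: Phi (row i v) = Phi ((\row_i c i) *m v).
  rewrite /Phi; under eq_bigr do rewrite scaler_sumr.
  rewrite exchange_big/=; apply: eq_bigr => j _.
  by rewrite mxE scaler_suml; apply: eq_bigr => i _; rewrite !mxE scalerA.
(* By [P_Phi] the matrix acts on row vectors, so the range of [P] is the row space of [Q]. *)
exists (fun i => Phi (row i (row_base Q))); split=> [c|].
  rewrite PhiD => c0 i; have : Phi 0 = 0 by rewrite /Phi big1// => j _; rewrite mxE scale0r.
  rewrite -c0 => /Phi_inj /esym /eqP; rewrite mulmx_free_eq0 ?row_base_free//.
  by move=> /eqP/rowP/(_ i); rewrite !mxE.
apply/seteqP; split=> psi /=.
  move=> [spsi Ppsi]; pose c : 'rV[R[i]]_#|I| := \row_i coef (enum_val i) psi.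
  have psiE : psi = Phi c.
    by rewrite PhiE {1}(expand spsi); apply: eq_bigr => x _; rewrite mxE enum_rankK.
  have cQ : c *m Q = c by apply: Phi_inj; rewrite -P_Phi -psiE.
  have : (c <= row_base Q)%MS by rewrite eq_row_base -cQ submxMl.
  move=> /submxP[D cD]; exists (fun i => D 0 i).
  by rewrite PhiD psiE cD; congr (Phi (_ *m _)); apply/rowP => i; rewrite mxE.
move=> [c ->]; rewrite PhiD; split; first exact: supp_Phi.
rewrite P_Phi -mulmxA; congr (Phi (_ *m _)).
have /submxP[D ->] : (row_base Q <= Q)%MS by rewrite eq_row_base.
by rewrite -mulmxA QQ.
Qed.

End IdempotentRange.
End Dimension.

(** * Shells of D^2 and spectral projections of D *)

Lemma dirac_symbolE (R : realType) (tau : R[i]) eps a :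
  dirac_symbol tau eps a = clifford (a.1.1%:~R + half R eps.1.1)
    ((a.1.2%:~R + half R eps.1.2)%:C + tau * (a.2%:~R + half R eps.2)%:C).
Proof. by case: eps a => [[e1 e2] e3] [[k l] m]. Qed.

Section DiracModes.
Variable R : realType.
Variables (tau : R[i]) (eps : spinstr).
Hypothesis tau_nonreal : complex.Im tau != 0.

Definition momentum_sqr (a : lattice) : R :=
  let x := a.1.1%:~R + half R eps.1.1 in
  let y := a.1.2%:~R + half R eps.1.2 in
  let t := a.2%:~R + half R eps.2 in
  x ^+ 2 + (y + complex.Re tau * t) ^+ 2 + (complex.Im tau * t) ^+ 2.

Lemma dirac_symbol_sqr a (v : 'cV[R[i]]_2) :
  dirac_symbol tau eps a *m (dirac_symbol tau eps a *m v) =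
  (momentum_sqr a)%:C *: v.
Proof.
rewrite mulmxA -mul_scalar_mx; congr (_ *m v).
rewrite dirac_symbolE /momentum_sqr.
set x := _ + half R eps.1.1; set y := _ + half R eps.1.2; set t := _ + half R eps.2.
case: tau => c s /=.
apply/matrixP => i j; rewrite !mxE big_ord_recl big_ord1 !mxE /=.
case: i j => [[|[|//]] ?] [[|[|//]] ?] /=;
  apply/eqP; rewrite eq_complex /=; apply/andP; split; apply/eqP => /=; ring.
Qed.

Lemma dirac_symbol0 a : momentum_sqr a = 0 -> dirac_symbol tau eps a = 0.
Proof.
rewrite dirac_symbolE /momentum_sqr.
set x := _ + half R eps.1.1; set y := _ + half R eps.1.2; set t := _ + half R eps.2.
case: tau => c s /= /eqP; rewrite !paddr_eq0 ?addr_ge0 ?sqr_ge0// !sqrf_eq0.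
move=> /andP[/andP[/eqP x0 /eqP u0] /eqP v0].
apply/matrixP => i j; rewrite !mxE.
case: i j => [[|[|//]] ?] [[|[|//]] ?] /=;
  apply/eqP; rewrite eq_complex /=; apply/andP; split; apply/eqP => /=; lra.
Qed.

Lemma half_bound (k : int) (e : bool) (M : R) :
  `|k%:~R + half R e| <= M -> `|k%:~R : R| <= M + 1.
Proof.
have : 0 <= half R e <= 1 by rewrite /half; case: e => /=; lra.
rewrite !ler_norml; lra.
Qed.

(** The momenta form a lattice coset in Euclidean space. In the skew coordinates [t] has to be
    bounded first, through Im tau != 0, and only then [y], from y + Re tau * t. *)
Lemma finite_modes q : exists s : seq lattice,
  uniq s /\ forall a, (a \in s) = (momentum_sqr a == q).
Proof.
pose c := complex.Re tau; pose d := complex.Im tau.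
(* [M1], [M2], [M3] will bound |x|, |t| and |y|; the further 1 in [B] makes up for the shift by eps
   in {0, 1/2}. *)
pose M1 := `|q| + 1; pose M2 := M1 / `|d|; pose M3 := M1 + `|c| * M2.
have M10 : 0 <= M1 by rewrite addr_ge0.
have M20 : 0 <= M2 by rewrite divr_ge0.
have M30 : 0 <= M3 by rewrite addr_ge0// mulr_ge0.
pose B := (Num.truncn (M1 + M2 + M3 + 1)%R).+1.
have B0 : M1 + M2 + M3 + 1 < B%:R by exact: truncnS_gt.
pose line := [seq (i%:Z - B%:Z) | i <- iota 0 (B + B).+1].
have in_line (k : int) : `|k%:~R : R| <= M1 + M2 + M3 + 1 -> k \in line.
  move=> kM; have : `|k|%:~R < B%:R :> R by rewrite intr_norm (le_lt_trans kM).
  rewrite -[B%:R]/(B%:Z%:~R) ltr_int => kB.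
  by apply/mapP; exists (absz (k + B%:Z)); rewrite ?mem_iota; lia.
pose box := [seq (kl, m) | kl <- [seq (k, l) | k <- line, l <- line], m <- line].
exists (undup [seq a <- box | momentum_sqr a == q]); split; first exact: undup_uniq.
move=> a; rewrite mem_undup mem_filter andb_idr// => /eqP aq.
have sq_le (x : R) : x ^+ 2 <= q -> `|x| <= M1.
  move=> xq; have : `|x| ^+ 2 <= `|q|.
    by rewrite real_normK ?num_real// (le_trans xq)// ler_norm.
  rewrite /M1; have := normr_ge0 x; have := normr_ge0 q; nra.
case: a aq => [[k l] m]; rewrite /momentum_sqr /= -/c -/d.
set x := k%:~R + _; set y := l%:~R + _; set t := m%:~R + _ => aq.
have s1 := sqr_ge0 x; have s2 := sqr_ge0 (y + c * t); have s3 := sqr_ge0 (d * t).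
have xM : `|x| <= M1 by apply: sq_le; lra.
have tM : `|t| <= M2.
  rewrite ler_pdivlMr ?normr_gt0// -normrM mulrC; apply: sq_le; lra.
have yM : `|y| <= M3.
  have : `|y + c * t| <= M1 by apply: sq_le; lra.
  have : `|c * t| <= `|c| * M2 by rewrite normrM ler_wpM2l.
  rewrite /M3 !ler_norml; lra.
have [[xb yb] tb] := (half_bound xM, half_bound yM, half_bound tM).
apply: (allpairs_f pair); last by apply: in_line; lra.
by apply: (allpairs_f pair); apply: in_line; lra.
Qed.

Definition modes (q : R) : seq lattice := sval (cid (finite_modes q)).

Lemma modes_uniq q : uniq (modes q).
Proof. by rewrite /modes; case: cid => s []. Qed.

Lemma mem_modes q a : (a \in modes q) = (momentum_sqr a == q).
Proof. by rewrite /modes; case: cid => s []. Qed.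

Lemma l2_supp_in (s : seq lattice) (psi : spinor R) : supp_in s psi -> l2 psi.
Proof.
move=> spsi; apply: (abs_summable_supp (S := [set` s])).
  move=> a /= /negP sa; rewrite /sqnorm spsi// big1// => i _.
  by rewrite mxE/= expr0n addr0.
rewrite /abs_summable /summable esum_fset ?fsbig_finite//=.
by rewrite sumEFin ltry.
Qed.

Lemma dirac_linear (c : R[i]) (psi phi : spinor R) :
  dirac tau eps (c *: psi + phi) = c *: dirac tau eps psi + dirac tau eps phi.
Proof. by apply/funext => a; rewrite /dirac mulmxDr -scalemxAr. Qed.

Lemma diracZ (c : R[i]) (psi : spinor R) :
  dirac tau eps (c *: psi) = c *: dirac tau eps psi.
Proof. by apply/funext => a; rewrite /dirac -scalemxAr. Qed.

Lemma dirac_sum (I : Type) (r : seq I) (F : I -> spinor R) :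
  dirac tau eps (\sum_(i <- r) F i) = \sum_(i <- r) dirac tau eps (F i).
Proof. by apply/funext => a; rewrite /dirac !fct_sumE mulmx_sumr. Qed.

Lemma supp_in_dirac s psi : supp_in s psi -> supp_in s (dirac tau eps psi).
Proof. by move=> spsi a /spsi; rewrite /dirac => ->; rewrite mulmx0. Qed.

Lemma supp_in_linear s (c : R[i]) (psi phi : spinor R) :
  supp_in s psi -> supp_in s phi -> supp_in s (c *: psi + phi).
Proof.
move=> spsi sphi a sa; transitivity (c *: psi a + phi a) => //.
by rewrite spsi// sphi// scaler0 addr0.
Qed.

Lemma dom_dirac_supp_in s psi : supp_in s psi -> dom_dirac tau eps psi.
Proof.
by move=> spsi; split; apply: (@l2_supp_in s) => //; exact: supp_in_dirac.
Qed.

(** The Clifford relation makes D^2 scalar on each mode. Characterising the shell by an equation in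
    D is what makes it stable under the lift, which commutes with D. *)
Lemma dirac_sqr_modes q psi : supp_in (modes q) psi <->
  dirac tau eps (dirac tau eps psi) = q%:C *: psi.
Proof.
split=> [spsi|dd a].
  apply/funext => a; rewrite /dirac dirac_symbol_sqr.
  have [|na] := boolP (a \in modes q); first by rewrite mem_modes => /eqP ->.
  by transitivity (q%:C *: psi a); rewrite // spsi// !scaler0.
rewrite mem_modes => na; have /(congr1 (fun phi => phi a)) := dd.
rewrite /dirac dirac_symbol_sqr => e.
have {}e : (momentum_sqr a)%:C *: psi a = q%:C *: psi a by [].
have /eqP : (momentum_sqr a - q)%:C *: psi a = 0 by rewrite rmorphB scalerBl e subrr.
rewrite scaler_eq0 => /orP[|/eqP//]; rewrite fmorph_eq0 subr_eq0.
by rewrite (negbTE na).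
Qed.

Lemma supp_in_eigen lam psi : dirac tau eps psi = lam%:C *: psi ->
  supp_in (modes (lam ^+ 2)) psi.
Proof.
move=> e; apply/dirac_sqr_modes; rewrite e diracZ e scalerA; congr (_ *: _).
by rewrite -rmorphM.
Qed.

(* The spectral projection (1 + D / lam) / 2 of D restricted to the shell
   D^2 = lam^2.  For [lam = 0], where D vanishes on the shell and [0^-1 = 0],
   the coefficient is adjusted so that it is the identity. *)
Definition eigen_coef (lam : R) : R := if lam == 0 then 1 else 2^-1.

Definition eigen_proj (lam : R) (psi : spinor R) : spinor R :=
  (eigen_coef lam)%:C *: ((lam^-1)%:C *: dirac tau eps psi + psi).

Lemma eigen_proj_linear lam (c : R[i]) (psi phi : spinor R) :
  eigen_proj lam (c *: psi + phi) = c *: eigen_proj lam psi + eigen_proj lam phi.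
Proof.
rewrite /eigen_proj dirac_linear !scalerDr !scalerA.
rewrite [_ * c]mulrC -!addrA; congr (_ + _).
  by congr (_ *: _); ring.
rewrite [in RHS]addrCA; congr (_ + _); congr (_ + _); congr (_ *: _); exact: mulrC.
Qed.

Lemma supp_in_eigen_proj s lam psi : supp_in s psi -> supp_in s (eigen_proj lam psi).
Proof.
move=> spsi; have s0 : supp_in s (0 : spinor R) by [].
rewrite /eigen_proj -[_ *: _]addr0; apply: supp_in_linear => //.
by apply: supp_in_linear => //; exact: supp_in_dirac.
Qed.

Lemma eigen_projP lam psi : supp_in (modes (lam ^+ 2)) psi ->
  eigen_proj lam psi = psi <-> dirac tau eps psi = lam%:C *: psi.
Proof.
move=> spsi; have [lam0|lam0] := eqVneq lam 0.
  rewrite /eigen_proj /eigen_coef lam0 eqxx invr0 scale0r add0r !scale1r scale0r.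
  split=> // _; apply/funext => a; rewrite /dirac.
  have [|na] := boolP (a \in modes (lam ^+ 2)); last by rewrite spsi// mulmx0.
  by rewrite mem_modes lam0 expr0n => /eqP /dirac_symbol0 ->; rewrite mul0mx.
rewrite /eigen_proj /eigen_coef (negbTE lam0).
have lamC : lam%:C != 0 by rewrite fmorph_eq0.
have lamK (phi : spinor R) : (lam^-1)%:C *: (lam%:C *: phi) = phi.
  by rewrite scalerA -rmorphM mulVf// rmorph1 scale1r.
have half2 : (2^-1)%:C *: (psi + psi) = psi.
  by rewrite scalerDr -scalerDl -rmorphD (_ : 2^-1 + 2^-1 = 1) ?rmorph1 ?scale1r//; field.
split=> [e|->]; last by rewrite lamK.
have lamCV : (lam^-1)%:C != 0 by rewrite fmorph_eq0 invr_eq0.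
have h0 : (2^-1)%:C != 0 :> R[i] by rewrite fmorph_eq0 invr_eq0.
apply: (scalerI lamCV); rewrite lamK; apply: (addIr psi).
by apply: (scalerI h0); rewrite e half2.
Qed.

Lemma dirac_eigen_proj lam psi : supp_in (modes (lam ^+ 2)) psi ->
  dirac tau eps (eigen_proj lam psi) = lam%:C *: eigen_proj lam psi.
Proof.
move=> spsi; have [lam0|lam0] := eqVneq lam 0.
  have -> : eigen_proj lam psi = psi.
    by rewrite /eigen_proj /eigen_coef lam0 eqxx invr0 scale0r add0r !scale1r.
  apply/eigen_projP => //.
  by rewrite /eigen_proj /eigen_coef lam0 eqxx invr0 scale0r add0r !scale1r.
have dd := (dirac_sqr_modes _ _).1 spsi.
rewrite /eigen_proj diracZ dirac_linear dd [in RHS]scalerA [lam%:C * _]mulrC -scalerA.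
congr (_ *: _); rewrite scalerDr !scalerA -!rmorphM mulfV// scale1r addrC.
by congr (_ + _ *: _); congr (_%:C); field.
Qed.

Lemma eigen_proj_idem lam psi : supp_in (modes (lam ^+ 2)) psi ->
  eigen_proj lam (eigen_proj lam psi) = eigen_proj lam psi.
Proof.
by move=> spsi; apply/eigen_projP; [exact: supp_in_eigen_proj|exact: dirac_eigen_proj].
Qed.

End DiracModes.

(** * Multiplicities on the quotient and on the torus as traces *)

Section TraceFormula.
Variable R : realType.
Implicit Types (psi phi : spinor R).
Variables (tau : R[i]) (eps : spinstr) (M : bieberbach).
Variable rho : bgroup M -> spinor R -> spinor R.
Hypothesis tau_nonreal : complex.Im tau != 0.
Hypothesis rho_lift : spin_lift tau eps rho.

Local Notation shell := (modes eps tau_nonreal).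
Local Notation D := (dirac tau eps).
Local Notation Pr := (eigen_proj tau eps).

Let l2_modes q psi : supp_in (shell q) psi -> l2 psi.
Proof. exact: l2_supp_in. Qed.

Let rho_linear q g (c : R[i]) psi phi :
  supp_in (shell q) psi -> supp_in (shell q) phi ->
  rho g (c *: psi + phi) = c *: rho g psi + rho g phi.
Proof.
by move=> /l2_modes lpsi /l2_modes lphi; exact: (lift_linear rho_lift).
Qed.

Let rho0 g : rho g 0 = 0.
Proof.
have s0 : supp_in (shell 0) (0 : spinor R) by [].
have := rho_linear g 1 s0 s0; rewrite !scale1r addr0 => e.
by apply: (addrI (rho g 0)); rewrite addr0 -e.
Qed.

Let rhoZ q g (c : R[i]) psi :
  supp_in (shell q) psi -> rho g (c *: psi) = c *: rho g psi.
Proof.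
move=> spsi; rewrite -[c *: psi]addr0 (rho_linear g c spsi) ?rho0 ?addr0//.
Qed.

Let rho_sum q (I : Type) (r : seq I) g (F : I -> spinor R) :
  (forall i, supp_in (shell q) (F i)) ->
  rho g (\sum_(i <- r) F i) = \sum_(i <- r) rho g (F i).
Proof.
move=> sF; suff [] : supp_in (shell q) (\sum_(i <- r) F i) /\
  rho g (\sum_(i <- r) F i) = \sum_(i <- r) rho g (F i) by [].
elim: r => [|i r [sr IH]]; first by rewrite !big_nil rho0.
rewrite !big_cons -[F i]scale1r; split; first exact: supp_in_linear.
by rewrite (rho_linear g 1 (sF i) sr) IH !scale1r.
Qed.

Let dirac_rho q g psi : supp_in (shell q) psi -> D (rho g psi) = rho g (D psi).
Proof.
by move=> /(dom_dirac_supp_in tau eps)/(lift_dirac rho_lift g)[].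
Qed.

Lemma supp_in_lift q g psi :
  supp_in (shell q) psi -> supp_in (shell q) (rho g psi).
Proof.
move=> spsi; apply/dirac_sqr_modes.
have sD := supp_in_dirac tau eps spsi.
rewrite (dirac_rho g spsi) (dirac_rho g sD).
by have /dirac_sqr_modes dd := spsi; rewrite dd (rhoZ g _ spsi).
Qed.

Let n : R[i] := #|bgroup M|%:R.

Let n0 : n != 0.
Proof. by rewrite pnatr_eq0 -lt0n; apply/card_gt0P; exists 1%g. Qed.

Let avg (psi : spinor R) : spinor R := n^-1 *: \sum_g rho g psi.

Let supp_in_sum q (I : Type) (r : seq I) (F : I -> spinor R) :
  (forall i, supp_in (shell q) (F i)) -> supp_in (shell q) (\sum_(i <- r) F i).
Proof. by move=> sF a na; rewrite fct_sumE big1// => i _; rewrite sF. Qed.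

Let supp_inZ q (c : R[i]) psi : supp_in (shell q) psi -> supp_in (shell q) (c *: psi).
Proof.
move=> spsi a na; transitivity (c *: psi a) => //; by rewrite spsi// scaler0.
Qed.

Let supp_avg q psi : supp_in (shell q) psi -> supp_in (shell q) (avg psi).
Proof. by move=> spsi; apply: supp_inZ; apply: supp_in_sum => g; exact: supp_in_lift. Qed.

Let avg_linear q (c : R[i]) psi phi :
  supp_in (shell q) psi -> supp_in (shell q) phi ->
  avg (c *: psi + phi) = c *: avg psi + avg phi.
Proof.
move=> spsi sphi; rewrite /avg; under eq_bigr do rewrite (rho_linear _ c spsi sphi).
by rewrite big_split/= -scaler_sumr scalerDr !scalerA [_ * c]mulrC.
Qed.

Let dirac_avg q psi : supp_in (shell q) psi -> D (avg psi) = avg (D psi).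
Proof.
move=> spsi; rewrite /avg diracZ dirac_sum; congr (_ *: _).
by apply: eq_bigr => g _; exact: (dirac_rho g spsi).
Qed.

Let eigen_proj_avg q lam psi : supp_in (shell q) psi ->
  avg (Pr lam psi) = Pr lam (avg psi).
Proof.
move=> spsi; have sD := supp_in_dirac tau eps spsi.
rewrite /eigen_proj -[(eigen_coef lam)%:C *: (_ + psi)]addr0.
have s0 : supp_in (shell q) (0 : spinor R) by [].
rewrite (avg_linear _ _ s0); last exact: supp_in_linear.
rewrite (avg_linear _ sD spsi) -(dirac_avg spsi) (_ : avg 0 = 0) ?addr0//.
by rewrite /avg big1 ?scaler0.
Qed.

Let lift_avg q h psi : supp_in (shell q) psi -> rho h (avg psi) = avg psi.
Proof.
move=> spsi; rewrite /avg.
have sl g : supp_in (shell q) (rho g psi) by exact: supp_in_lift.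
rewrite (rhoZ (q := q)); last exact: supp_in_sum.
congr (_ *: _); rewrite (rho_sum (q := q))//.
rewrite [RHS](reindex_inj (mulgI h))/=; apply: eq_bigr => g _.
by rewrite (lift_mul rho_lift)//; exact: l2_modes spsi.
Qed.

Let avg_fixed psi : (forall g, rho g psi = psi) -> avg psi = psi.
Proof.
move=> fix_psi; rewrite /avg; under eq_bigr do rewrite fix_psi.
by rewrite sumr_const -scaler_nat scalerA mulVf// scale1r.
Qed.

(** The diagonal block of [rho g] at the mode [a]. As D is diagonal in the modes, the other blocks
    do not enter the trace of a spectral projection times [rho g]. *)
Definition lift_block (g : bgroup M) (a : lattice) : 'M[R[i]]_2 :=
  \matrix_(i, j) rho g (delta_spinor R a j) a i 0.

(** The trace of [eigen_proj lam] composed with [rho g] on the shell of [lam ^+ 2], that is, the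
    t_g(lam) of the overview. *)
Definition eigen_trace (g : bgroup M) (lam : R) : R[i] :=
  (eigen_coef lam)%:C * \sum_(a <- shell (lam ^+ 2))
    ((lam^-1)%:C * \tr (dirac_symbol tau eps a *m lift_block g a) +
     \tr (lift_block g a)).

(** On the shell [Pr lam] and [avg] are commuting projections, so their product projects onto the
    intersection of their ranges: the invariant eigenspinors. *)
Let has_dim_quotient lam : exists2 r,
  has_dim (eigenspace_on tau eps (invariant_spinors rho) lam) r &
  r%:R = \sum_(a <- shell (lam ^+ 2)) \sum_i
    Pr lam (avg (delta_spinor R a i)) a i 0.
Proof.
apply: (@has_dim_idempotent R (shell (lam ^+ 2)) _ (fun psi => Pr lam (avg psi))).
- exact: modes_uniq.
- by move=> psi spsi; apply: supp_in_eigen_proj; exact: supp_avg.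
- by move=> c psi phi spsi sphi; rewrite (avg_linear c spsi sphi) eigen_proj_linear.
- move=> psi spsi; have sa := supp_avg spsi.
  rewrite (eigen_proj_avg lam sa) eigen_proj_idem; last exact: supp_avg.
  congr (Pr _ _); apply: avg_fixed => g; exact: (lift_avg g spsi).
apply/seteqP; split=> psi /=.
  move=> [[_ fix_psi] Dpsi]; have spsi := supp_in_eigen (tau_nonreal := tau_nonreal) Dpsi.
  by split=> //; rewrite avg_fixed//; apply/(eigen_projP spsi).
move=> [spsi Ppsi]; split; last first.
  by rewrite -Ppsi; apply: dirac_eigen_proj; exact: supp_avg.
split=> [|g]; first exact: l2_modes spsi.
rewrite -Ppsi -(eigen_proj_avg lam spsi); apply: (lift_avg (q := lam ^+ 2)).
exact: supp_in_eigen_proj.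
Qed.

Let sum_col (A B : 'M[R[i]]_2) : \tr (A *m B) = \sum_i (A *m col i B) i 0.
Proof.
rewrite /mxtrace; apply: eq_bigr => i _; rewrite !mxE; apply: eq_bigr => j _.
by rewrite !mxE.
Qed.

Lemma multiplicity_quotient lam :
  n * (multiplicity tau eps (invariant_spinors rho) lam)%:R =
  \sum_g eigen_trace g lam.
Proof.
have [r /multiplicity_has_dim -> ->] := has_dim_quotient lam.
suff key a : n * (\sum_i Pr lam (avg (delta_spinor R a i)) a i 0) =
    (eigen_coef lam)%:C * \sum_g
      ((lam^-1)%:C * \tr (dirac_symbol tau eps a *m lift_block g a) +
       \tr (lift_block g a)).
  rewrite mulr_sumr (eq_bigr _ (fun a _ => key a)) -mulr_sumr exchange_big/=.
  by rewrite mulr_sumr.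
have avgE i : avg (delta_spinor R a i) a = col i (n^-1 *: \sum_g lift_block g a).
  apply/colP => k; rewrite [RHS]mxE [RHS]mxE summxE.
  transitivity ((n^-1 *: (\sum_g rho g (delta_spinor R a i)) a) k 0); first by [].
  by rewrite mxE fct_sumE summxE; congr (_ * _); apply: eq_bigr => g _; rewrite mxE.
transitivity (n * \sum_i (eigen_coef lam)%:C *
   ((lam^-1)%:C * (dirac_symbol tau eps a *m col i (n^-1 *: \sum_g lift_block g a)) i 0 +
    col i (n^-1 *: \sum_g lift_block g a) i 0)).
  by congr (_ * _); apply: eq_bigr => i _; rewrite -avgE !mxE.
rewrite -mulr_sumr big_split/= -mulr_sumr -sum_col.
have -> : \sum_i col i (n^-1 *: \sum_g lift_block g a) i 0 =
    n^-1 * \sum_g \tr (lift_block g a).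
  rewrite -raddf_sum/= -mxtraceZ; apply: eq_bigr => i _; by rewrite !mxE.
rewrite -scalemxAr mxtraceZ mulmx_sumr raddf_sum/= [in RHS]big_split/= -mulr_sumr.
by rewrite mulrCA; congr (_ * _); rewrite mulrCA -mulrDr mulrA mulfV// mul1r.
Qed.

Lemma multiplicity_torus lam :
  (multiplicity tau eps (@l2 R) lam)%:R = eigen_trace 1%g lam.
Proof.
have [] := @has_dim_idempotent R (shell (lam ^+ 2)) (modes_uniq _ _ _)
    (Pr lam) _ _ _ (eigenspace_on tau eps (@l2 R) lam).
- exact: supp_in_eigen_proj.
- by move=> c psi phi _ _; exact: eigen_proj_linear.
- exact: eigen_proj_idem.
- apply/seteqP; split=> psi /= [h Dpsi].
    have spsi := supp_in_eigen (tau_nonreal := tau_nonreal) Dpsi.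
    by split=> //; apply/(eigen_projP spsi).
  by split; [exact: l2_modes h|apply/(eigen_projP h)].
move=> r /multiplicity_has_dim -> ->; rewrite /eigen_trace mulr_sumr.
apply: eq_bigr => a _.
(* Writing the torus multiplicity through the lift of 1 makes it literally the term g = 1 of
   [multiplicity_quotient]. *)
have block1 : lift_block 1 a = 1%:M.
  apply/matrixP => i j; rewrite !mxE (lift_one rho_lift).
    by rewrite /delta_spinor eqxx !mxE eqxx andbT.
  apply: (@l2_supp_in _ [:: a]) => b; rewrite inE /delta_spinor => /negbTE -> //.
have deltaE i : delta_spinor R a i a = col i 1%:M.
  by rewrite /delta_spinor eqxx col1.
transitivity (\sum_i (eigen_coef lam)%:C *
   ((lam^-1)%:C * (dirac_symbol tau eps a *m col i 1%:M) i 0 + col i 1%:M i 0)).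
  by apply: eq_bigr => i _; rewrite -deltaE !mxE.
rewrite -mulr_sumr big_split/= -mulr_sumr -sum_col block1; congr (_ * (_ + _)).
by apply: eq_bigr => i _; rewrite mxE.
Qed.

End TraceFormula.

(** * Traces of rotations *)

Section Geometric.
Variables (F : fieldType) (n : nat) (w : F) (u : int -> F).
Hypothesis u_geom : forall k, u (k + 1) = w * u k.

Lemma geometric_nat k (r : nat) : u (k + r%:Z) = w ^+ r * u k.
Proof.
elim: r => [|r IH]; first by rewrite addr0 mul1r.
by rewrite -[r.+1]addn1 PoszD addrA u_geom IH addn1 exprS mulrA.
Qed.

Lemma geometric_period k : w ^+ n = 1 -> u (k + n%:Z) = u k.
Proof. by move=> wn; rewrite geometric_nat wn mul1r. Qed.

Lemma geometric_sum0 : w ^+ n = 1 -> w != 1 -> \sum_(r < n) u r%:Z = 0.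
Proof.
move=> wn w1; have -> : \sum_(r < n) u r%:Z = (\sum_(r < n) w ^+ r) * u 0.
  by rewrite mulr_suml; apply: eq_bigr => r _; rewrite -(geometric_nat 0) add0r.
have /eqP := subrX1 w n; rewrite wn subrr eq_sym mulf_eq0 subr_eq0 (negbTE w1)/=.
by move=> /eqP ->; rewrite mul0r.
Qed.

End Geometric.

Lemma big_seq_two (V : nmodType) (T : eqType) (s : seq T) (x y : T) (F : T -> V) :
  uniq s -> x \in s -> y \in s -> x != y ->
  (forall z, z \in s -> z != x -> z != y -> F z = 0) ->
  \sum_(z <- s) F z = F x + F y.
Proof.
move=> us xs ys xy F0; rewrite (bigD1_seq x)//= big_mkcond (bigD1_seq y)//=.
rewrite eq_sym xy big1_seq ?addr0// => z /andP[zy zs].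
by case: ifPn => // zx; rewrite F0.
Qed.

Lemma big_seq_one (V : nmodType) (T : eqType) (s : seq T) (x : T) (F : T -> V) :
  uniq s -> x \in s -> (forall z, z \in s -> z != x -> F z = 0) ->
  \sum_(z <- s) F z = F x.
Proof.
by move=> us xs F0; rewrite (bigD1_seq x)//= big1_seq ?addr0// => z /andP[zx /F0->].
Qed.

Section AxialTrace.
Variable R : realType.
Variables (tau : R[i]) (eps : spinstr) (M : bieberbach).
Variable rho : bgroup M -> spinor R -> spinor R.
Hypothesis tau_nonreal : complex.Im tau != 0.
Variable g : bgroup M.

Local Notation block := (lift_block rho g).

(* The modes fixed by [g] are those with momentum on the rotation axis; they
   form a line along which the phase of [g] turns by [w] at each step.  If no
   mode has its momentum on the axis, all the blocks vanish. *)
Definition axial (n : nat) := exists (line : int -> lattice) (w : R[i]) (e : bool),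
  [/\ w ^+ n = 1, w != 1, injective line,
      forall k, block (line (k + 1)) = w *: block (line k) &
      (forall a, block a = 0) \/ exists C : 'M[R[i]]_2,
       [/\ forall k, dirac_symbol tau eps (line k) = (k%:~R + half R e)%:C *: C,
           forall k, momentum_sqr tau eps (line k) = (k%:~R + half R e) ^+ 2 &
           forall a, block a != 0 -> exists k, a = line k]].

Let trace_term lam a : R[i] :=
  (lam^-1)%:C * \tr (dirac_symbol tau eps a *m block a) + \tr (block a).

Let trace_term0 lam a : block a = 0 -> trace_term lam a = 0.
Proof. by rewrite /trace_term => ->; rewrite mulmx0 mxtrace0 mulr0 addr0. Qed.

(** For lam = k + x0 the only modes of the shell that lie on the axis are those with coordinates lam
    and -lam, at k and k' = - k - e. The spectral projection acts there as (1 + C) / 2 and (1 - C) /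
    2. As k grows k' decreases, so that the second contribution is geometric with ratio w^-1. *)
Lemma axial_oscillating n : (0 < n)%N -> axial n ->
  oscillating n (fun lam => complex.Re (eigen_trace eps rho tau_nonreal g lam)).
Proof.
move=> n0 [line [w [e [wn w1 line_inj geom [blk0|[C [DC mC supp]]]]]]].
  have t0 lam : complex.Re (eigen_trace eps rho tau_nonreal g lam) = 0.
    by rewrite /eigen_trace big1 ?mulr0// => a _; exact: trace_term0.
  by exists 0; split=> [k||x _]; rewrite ?t0//; apply: big1 => r _; rewrite t0.
pose x0 := half R e; pose m k := \tr (block (line k)).
pose q k := \tr (C *m block (line k)).
pose h : R[i] := (2^-1)%:C.
have hh : h + h = 1 by rewrite /h -rmorphD (_ : 2^-1 + 2^-1 = 1) ?rmorph1//; field.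
(* [u] and [v] are the contributions of the modes at k and at k' = - k - e to the trace at lam = k +
   x0. *)
pose u k := h * (m k + q k); pose v k := h * (m (- k - e%:Z) - q (- k - e%:Z)).
have x0E : x0 + x0 = (e%:Z)%:~R :> R.
  by rewrite /x0 /half -[(e%:Z)%:~R]/(e%:R); field.
have u_geom k : u (k + 1) = w * u k.
  by rewrite /u /m /q geom -scalemxAr !mxtraceZ; ring.
have w0 : w != 0.
  by apply: contraTneq n0 => w0; move: wn; rewrite w0 expr0n -eqn0Ngt; case: eqP => // _ /eqP;
    rewrite eq_sym oner_eq0.
have wVn : w^-1 ^+ n = 1 by rewrite exprVn wn invr1.
have v_geom k : v (k + 1) = w^-1 * v k.
  rewrite /v (_ : - k - e%:Z = - (k + 1) - e%:Z + 1); last by ring.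
  by rewrite /m /q geom -scalemxAr !mxtraceZ; field.
have line_mem k lam : lam = k%:~R + x0 -> line k \in modes eps tau_nonreal (lam ^+ 2).
  by move=> ->; rewrite mem_modes mC.
have mem_line a lam : a \in modes eps tau_nonreal (lam ^+ 2) -> block a != 0 ->
    exists2 k, a = line k & lam = k%:~R + x0 \/ - lam = k%:~R + x0.
  move=> + /supp[k ak]; rewrite mem_modes ak mC eqf_sqr => /orP[]/eqP lamk; exists k => //.
    by left; rewrite -lamk.
  by right; rewrite -lamk.
have flip (k : int) : - (k%:~R + x0) = (- k - e%:Z)%:~R + x0.
  by rewrite rmorphB rmorphN/= -x0E; ring.
have traceE k : eigen_trace eps rho tau_nonreal g (k%:~R + x0) = u k + v k.
  set lam := k%:~R + x0; pose k' := - k - e%:Z.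
  have lam' : - lam = k'%:~R + x0 by exact: flip.
  rewrite /eigen_trace /eigen_coef.
  under eq_bigr do rewrite -/(trace_term lam _).
  have [l0|l0] := eqVneq lam 0.
    (* At lam = 0 the two modes coincide and the projection is the identity; u + v is still right
       since (1 + C) / 2 + (1 - C) / 2 = 1. *)
    have kk' : k' = k by apply: (@intr_inj R); apply: (addIr x0); rewrite -lam' -/lam l0 oppr0.
    rewrite (big_seq_one (x := line k)) ?modes_uniq ?line_mem//; last first.
      move=> a alam ak; apply/trace_term0/eqP.
      apply: contraNT ak => /(mem_line _ _ alam)[j -> hj].
      apply/eqP; congr line; apply: (@intr_inj R); apply: (addIr x0).
      by case: hj => <-; rewrite -/lam l0 ?oppr0.
    rewrite /trace_term l0 invr0 rmorph0 mul0r add0r rmorph1 mul1r /u /v -/k' kk' -/(m k).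
    by rewrite -[LHS]mul1r -hh; ring.
  have kk' : line k != line k'.
    apply: contra l0 => /eqP /line_inj kk'.
    have : lam = - lam by rewrite lam' -kk'.
    by move=> ?; apply/eqP; lra.
  have xm : line k \in modes eps tau_nonreal (lam ^+ 2) by exact: line_mem.
  have ym : line k' \in modes eps tau_nonreal (lam ^+ 2) by rewrite -sqrrN line_mem.
  rewrite (big_seq_two (modes_uniq _ _ _) xm ym kk'); last first.
    move=> a alam ak ak'; apply/trace_term0/eqP.
    apply: contraNT ak => /(mem_line _ _ alam)[j aj hj].
    case: hj => hj.
      rewrite aj; apply/eqP; congr line; apply: (@intr_inj R); apply: (addIr x0).
      by rewrite -hj.
    case/eqP: ak'; rewrite aj; congr line; apply: (@intr_inj R); apply: (addIr x0).
    by rewrite -hj lam'.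
  rewrite /trace_term !DC -!scalemxAl !mxtraceZ -/lam -/x0 -lam' !mulrA -!rmorphM mulVf//.
  by rewrite mulrN mulVf// rmorphN rmorph1 /u /v -/(m k) -/(m k') -/(q k) -/(q k') -/h; ring.
exists x0; split=> [k||x xk].
- rewrite (traceE (k + n%:Z)) (traceE k).
  by rewrite (geometric_period u_geom k wn) (geometric_period v_geom k wVn).
- transitivity (complex.Re (\sum_(r < n) (u r%:Z + v r%:Z))).
    rewrite (raddf_sum (@complex.Re R : Rcomplex R -> R)); apply: eq_bigr => r _.
    by rewrite -(traceE r%:Z).
  rewrite big_split/= (geometric_sum0 u_geom wn w1) (geometric_sum0 v_geom wVn _) ?addr0//.
  by rewrite invr_eq1.
- rewrite /eigen_trace big1_seq ?mulr0// => a /andP[_ amem]; apply/trace_term0/eqP.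
  apply: contraPT xk => /(mem_line _ _ amem)[k _ [->|xk]] /(_ _)/eqP.
    by move=> /(_ k); rewrite eqxx.
  move=> /(_ (- k - e%:Z)); rewrite -flip -xk opprK eqxx //.
Qed.

End AxialTrace.

(** * Rotation axes of the elements of G *)

Section MonomialOperators.
Variable R : realType.
Implicit Types (psi phi : spinor R) (x y : monomial R) (v w : lattice).

Lemma sqnormZ (c : R[i]) (u : 'cV[R[i]]_2) :
  sqnorm (c *: u) = (complex.Re c ^+ 2 + complex.Im c ^+ 2) * sqnorm u.
Proof.
rewrite /sqnorm mulr_sumr; apply: eq_bigr => i _; rewrite mxE.
by case: c (u i 0) => a b [a' b'] /=; ring.
Qed.

Lemma l2_mono_op x psi : l2 psi -> l2 (mono_op x psi).
Proof.
case: x => c w lpsi; rewrite /l2 /mono_op /=.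
have e : (fun a : lattice => a - w) @` setT = setT.
  by apply/seteqP; split=> // a _; exists (a + w) => //; rewrite addrK.
have sh : abs_summable setT (fun a => sqnorm (psi (a - w))).
  apply: (abs_summable_image (fun a => sqnorm (psi a)) _).1.
    by move=> a b _ _ /addIr.
  by rewrite e.
apply: abs_summable_le (abs_summableZ (complex.Re c ^+ 2 + complex.Im c ^+ 2) sh) => a _.
by rewrite sqnormZ.
Qed.

Lemma mono_opZ c w psi : mono_op (c, w) psi = c *: mono_op (1, w) psi.
Proof.
apply/funext => a; transitivity (c *: mono_op (1, w) psi a) => //.
by rewrite /mono_op scale1r.
Qed.

Lemma mono_opD v w psi : mono_op (1, v + w) psi = mono_op (1, v) (mono_op (1, w) psi).
Proof. by apply/funext => a; rewrite /mono_op !scale1r opprD addrA. Qed.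

Lemma mono_op_scale v c psi : mono_op (1, v) (c *: psi) = c *: mono_op (1, v) psi.
Proof.
apply/funext => a; transitivity (c *: mono_op (1, v) psi a) => //.
by rewrite /mono_op /= !scale1r.
Qed.

Lemma mono_op0 psi : mono_op (1, 0) psi = psi.
Proof. by apply/funext => a; rewrite /mono_op scale1r subr0. Qed.

Lemma mono_op_delta v a i :
  mono_op (1, v) (delta_spinor R a i) = delta_spinor R (a + v) i.
Proof.
by apply/funext => b; rewrite /mono_op scale1r /delta_spinor subr_eq.
Qed.

End MonomialOperators.

(** Applied to the momentum components transverse to an axis: if the spin structure is antiperiodic
    in such a direction, no mode lies on the axis. *)
Lemma half_int_eq0 (R : realType) (k : int) (e : bool) :
  k%:~R + half R e = 0 -> k = 0 /\ e = false.
Proof.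
move=> h; have : (k + k + e%:Z)%:~R = 0 :> R.
  rewrite !rmorphD/= (_ : (e%:Z)%:~R = half R e + half R e); first by lra.
  by rewrite /half -[(e%:Z)%:~R]/(e%:R); field.
by move=> /eqP; rewrite intr_eq0 => /eqP; case: e {h} => /=; lia.
Qed.

(** * Translations of modes and the diagonal blocks of the lift *)

Section Intertwiners.
Variable R : realType.
Variables (tau : R[i]) (eps : spinstr) (M : bieberbach).
Variable rho : bgroup M -> spinor R -> spinor R.
Hypothesis tau_nonreal : complex.Im tau != 0.
Hypothesis rho_lift : spin_lift tau eps rho.
Implicit Types (g h : bgroup M) (v w u : lattice) (c d : R[i]).

Definition intertwines g v (y : monomial R) := forall psi, l2 psi ->
  rho g (mono_op (1, v) psi) = mono_op y (rho g psi).

Lemma lift_scale g c psi : l2 psi -> rho g (c *: psi) = c *: rho g psi.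
Proof.
move=> lpsi; have l0 : l2 (0 : spinor R) by exact: (@l2_supp_in _ [::]).
have rho0 : rho g 0 = 0.
  have := lift_linear rho_lift g 1 l0 l0; rewrite !scale1r addr0 => e.
  by apply: (addrI (rho g 0)); rewrite addr0 -e.
by rewrite -[c *: psi]addr0 (lift_linear rho_lift g c lpsi l0) rho0 addr0.
Qed.

Lemma intertwines0 g : intertwines g 0 (1, 0).
Proof. by move=> psi lpsi; rewrite !mono_op0. Qed.

Lemma intertwinesD g v w c d v' w' :
  intertwines g v (c, v') -> intertwines g w (d, w') ->
  intertwines g (v + w) (c * d, v' + w').
Proof.
move=> hv hw psi lpsi; rewrite mono_opD hv ?hw//; last exact: l2_mono_op.
rewrite [LHS]mono_opZ [mono_op (d, _) _]mono_opZ mono_op_scale -mono_opD scalerA.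
by rewrite [RHS]mono_opZ.
Qed.

Lemma intertwinesN g v c w : c != 0 ->
  intertwines g v (c, w) -> intertwines g (- v) (c^-1, - w).
Proof.
move=> c0 hv psi lpsi; have lv := l2_mono_op (1, - v) lpsi.
have := hv _ lv; rewrite -mono_opD subrr mono_op0 => ->.
rewrite [RHS]mono_opZ [mono_op (c, w) _]mono_opZ mono_op_scale -mono_opD addNr mono_op0.
by rewrite scalerA mulVf// scale1r.
Qed.

Lemma intertwines_comp g h v w u c d :
  intertwines h v (c, w) -> intertwines g w (d, u) ->
  intertwines (g * h)%g v (c * d, u).
Proof.
move=> hv hw psi lpsi; have lh := lift_l2 rho_lift h lpsi.
rewrite !(lift_mul rho_lift)//; last exact: l2_mono_op.
rewrite hv// mono_opZ lift_scale ?hw//; last exact: l2_mono_op.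
by rewrite mono_opZ scalerA [RHS]mono_opZ.
Qed.

(** The multiples of [v] and [w] are passed as functions satisfying a recursion, so that explicit
    triples such as [(0, k, 0)] can be used for them. *)
Lemma intertwinesMz g v w (v_ : int -> lattice) (w_ : int -> lattice) :
  intertwines g v (1, w) -> v_ 0 = 0 -> w_ 0 = 0 ->
  (forall k, v_ (k + 1) = v_ k + v) -> (forall k, w_ (k + 1) = w_ k + w) ->
  forall k, intertwines g (v_ k) (1, w_ k).
Proof.
move=> hv v0 w0 vS wS; have hVn := intertwinesN (oner_neq0 _) hv.
have step k : intertwines g (v_ k) (1, w_ k) -> intertwines g (v_ (k + 1)) (1, w_ (k + 1)).
  by move=> IH; rewrite vS wS -[1]mulr1; exact: intertwinesD.
have back k : intertwines g (v_ k) (1, w_ k) -> intertwines g (v_ (k - 1)) (1, w_ (k - 1)).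
  move=> IH; have := intertwinesD IH hVn; rewrite invr1 mulr1.
  by rewrite -[in v_ k](subrK 1 k) -[in w_ k](subrK 1 k) vS wS !addrK.
have pos (n : nat) : intertwines g (v_ n) (1, w_ n).
  elim: n => [|n IH]; first by rewrite v0 w0; exact: intertwines0.
  by rewrite -[n.+1]addn1 PoszD; exact: step.
case=> // n; elim: n => [|n IH]; first by have := back 0 (pos 0%N); rewrite sub0r.
by have := back _ IH; rewrite !NegzE -opprD -PoszD addn1.
Qed.

Local Notation block := (lift_block rho).

Lemma lift_delta_shift g v w c : intertwines g v (c, w) ->
  forall a b i, rho g (delta_spinor R (a + v) i) (b + w) =
                c *: rho g (delta_spinor R a i) b.
Proof.
move=> hv a b i; rewrite -mono_op_delta hv; first by rewrite /mono_op /= addrK.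
by apply: (@l2_supp_in _ [:: a]) => a'; rewrite inE /delta_spinor => /negbTE ->.
Qed.

Lemma lift_block_shift g v c : intertwines g v (c, v) ->
  forall a, block g (a + v) = c *: block g a.
Proof.
by move=> hv a; apply/matrixP => i j; rewrite !mxE (lift_delta_shift hv) mxE.
Qed.

(** By equivariance an entry of the block at [a] is, up to the factor [c], the component at a + w of
    the image of a delta spinor at a + v. That image stays in the shell of a + v, so a nonzero entry
    puts a + w on the same shell. *)
Lemma lift_block_momentum g v w c a : c != 0 -> intertwines g v (c, w) ->
  block g a != 0 -> momentum_sqr tau eps (a + w) = momentum_sqr tau eps (a + v).
Proof.
move=> c0 hv /matrix0Pn[i [j]]; rewrite mxE => nz.
pose q := momentum_sqr tau eps (a + v).
have sd : supp_in (modes eps tau_nonreal q) (delta_spinor R (a + v) j).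
  by move=> b; rewrite mem_modes /delta_spinor; case: (b =P a + v) => // ->; rewrite eqxx.
have := @supp_in_lift _ _ _ _ _ tau_nonreal rho_lift q g _ sd (a + w).
rewrite (lift_delta_shift hv) mem_modes => h.
apply/eqP; apply: contraNT nz => /h /eqP; rewrite scaler_eq0 (negbTE c0)/=.
by move=> /eqP ->; rewrite mxE.
Qed.

(* The previous lemma for [v] and [- v]; by polarisation this says that the
   momentum of [a] has the same inner product with [v] and with its image [w]. *)
Lemma lift_block_polar g v w c a : c != 0 -> intertwines g v (c, w) ->
  block g a != 0 ->
  momentum_sqr tau eps (a + w) - momentum_sqr tau eps (a - w) =
  momentum_sqr tau eps (a + v) - momentum_sqr tau eps (a - v).
Proof.
move=> c0 hv nz; rewrite (lift_block_momentum c0 hv nz).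
by rewrite (lift_block_momentum _ (intertwinesN c0 hv) nz)// invr_eq0.
Qed.

(** The Euclidean inner product in the coordinates (x, y + Re tau * t, Im tau * t); [v] carries no
    shift by eps, being a difference of momenta. *)
Definition momentum_dot (a v : lattice) : R :=
  let x := a.1.1%:~R + half R eps.1.1 in
  let y := a.1.2%:~R + half R eps.1.2 in
  let t := a.2%:~R + half R eps.2 in
  let r := complex.Re tau in let s := complex.Im tau in
  x * v.1.1%:~R + (y + r * t) * (v.1.2%:~R + r * v.2%:~R) + s * t * (s * v.2%:~R).

Lemma momentum_sqr_polar a v :
  momentum_sqr tau eps (a + v) - momentum_sqr tau eps (a - v) = 4 * momentum_dot a v.
Proof.
case: a v => [[k l] m] [[k' l'] m']; rewrite /momentum_sqr /momentum_dot /=.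
by rewrite !rmorphD !rmorphN/=; ring.
Qed.

Lemma lift_block_dot g v w c a : c != 0 -> intertwines g v (c, w) ->
  block g a != 0 -> momentum_dot a w = momentum_dot a v.
Proof.
move=> c0 hv nz; have := lift_block_polar c0 hv nz.
rewrite !momentum_sqr_polar => h; lra.
Qed.

End Intertwiners.

(** * Roots of unity *)

Section RootsOfUnity.
Variable R : realType.

Lemma cisD (s t : R) : cis (s + t) = cis s * cis t.
Proof.
apply/eqP; rewrite /cis cosD sinD eq_complex /=.
by apply/andP; split; apply/eqP => /=; ring.
Qed.

Lemma cisX (t : R) n : cis t ^+ n = cis (n%:R * t).
Proof.
elim: n => [|n IH]; first by rewrite mul0r /cis cos0 sin0.
by rewrite exprS IH -cisD -[n.+1]add1n natrD mulrDl mul1r.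
Qed.

Lemma cis_neq1 (t : R) : 0 < t < 2 * pi -> cis t != 1.
Proof.
move=> /andP[t0 t2]; rewrite eq_complex /= negb_and lt_eqF//.
have s0 : 0 < sin (t / 2) by apply: sin_gt0_pi; apply/andP; split; lra.
have -> : t = t / 2 + t / 2 by field.
by rewrite cosD; have := cos2Dsin2 (t / 2); have := mulr_gt0 s0 s0; lra.
Qed.

Definition root_of_unity (n : nat) : R[i] := cis (2 * pi / n%:R).

Lemma root_of_unityX n : (0 < n)%N -> root_of_unity n ^+ n = 1.
Proof.
move=> n0; rewrite cisX mulrCA mulfV ?pnatr_eq0 -?lt0n// mulr1.
by rewrite /cis mulr_natl cos2pi sin2pi.
Qed.

Lemma root_of_unityX_neq1 n j : (0 < j < n)%N -> root_of_unity n ^+ j != 1.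
Proof.
move=> /andP[j0 jn]; rewrite cisX; apply: cis_neq1.
have n0 : 0 < n%:R :> R by rewrite ltr0n (leq_trans _ jn).
have p0 : 0 < 2 * pi :> R by rewrite mulr_gt0// pi_gt0.
rewrite mulrCA; apply/andP; split; first by rewrite mulr_gt0// divr_gt0// ltr0n.
by rewrite gtr_pMr// ltr_pdivrMr// mul1r ltr_nat.
Qed.

Lemma root_of_unity2 : root_of_unity 2 = -1.
Proof.
rewrite /root_of_unity mulrC mulKf// /cis cospi sinpi.
by apply/eqP; rewrite eq_complex /= oppr0 !eqxx.
Qed.

Lemma root_of_unity4 : root_of_unity 4 = 0 +i* 1.
Proof.
rewrite /root_of_unity (_ : 2 * pi / 4 = pi / 2 :> R); last by field.
by rewrite /cis cos_pihalf sin_pihalf.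
Qed.

Lemma root_of_unity6 : root_of_unity 6 = cis (pi / 3).
Proof. by rewrite /root_of_unity; congr cis; field. Qed.

End RootsOfUnity.

(** * Rotations about the directions of U, V and W *)

Section Axes.
Variable R : realType.
Variables (tau : R[i]) (eps : spinstr) (M : bieberbach).
Variable rho : bgroup M -> spinor R -> spinor R.
Hypothesis tau_nonreal : complex.Im tau != 0.
Hypothesis rho_lift : spin_lift tau eps rho.
Implicit Types (g h : bgroup M) (w c d : R[i]) (p q : int * int).

Local Notation block := (lift_block rho).

(* [p] and [q] are the exponents of V and W in the images of V and W. *)
Definition planar g w p q := [/\ intertwines rho g eU (w, eU),
  intertwines rho g eV (1, (0, p.1, p.2)) & intertwines rho g eW (1, (0, q.1, q.2))].

Lemma planar_linear g w p q (a b : int) : planar g w p q ->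
  intertwines rho g (0, a, b) (1, (0, a * p.1 + b * q.1, a * p.2 + b * q.2)).
Proof.
move=> [_ hV hW].
have hVa := intertwinesMz hV
  (v_ := fun k : int => (0, k, 0)) (w_ := fun k : int => (0, k * p.1, k * p.2)).
have hWb := intertwinesMz hW
  (v_ := fun k : int => (0, 0, k)) (w_ := fun k : int => (0, k * q.1, k * q.2)).
have := intertwinesD (hVa _ _ _ _ a) (hWb _ _ _ _ b).
rewrite mulr1 (_ : (0, a, 0) + (0, 0, b) = (0, a, b)); last first.
  by congr (_, _, _); rewrite ?addr0 ?add0r.
rewrite (_ : _ + _ = (0, a * p.1 + b * q.1, a * p.2 + b * q.2)) //.
apply; rewrite ?mul0r// => k; congr (_, _, _); rewrite ?addr0 ?mulrDl ?mul1r//.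
Qed.

(** Exponents are row vectors: the matrix of [g * h] is that of [h], with rows [p] and [q], times
    that of [g]. *)
Lemma planar_comp g h w w' p q p' q' : planar h w p q -> planar g w' p' q' ->
  planar (g * h)%g (w * w')
    (p.1 * p'.1 + p.2 * q'.1, p.1 * p'.2 + p.2 * q'.2)
    (q.1 * p'.1 + q.2 * q'.1, q.1 * p'.2 + q.2 * q'.2).
Proof.
move=> [hU hV hW] pg; have [gU _ _] := pg; split.
- exact: (intertwines_comp rho_lift hU gU).
- by have := intertwines_comp rho_lift hV (planar_linear p.1 p.2 pg); rewrite mulr1.
- by have := intertwines_comp rho_lift hW (planar_linear q.1 q.2 pg); rewrite mulr1.
Qed.

(** The determinant condition says that A - 1 is invertible for the matrix A with rows [p] and [q],
    so that no nonzero transverse momentum is fixed. *)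
Lemma planar_axial n g w p q : w ^+ n = 1 -> w != 1 ->
  (p.1 - 1) * (q.2 - 1) != p.2 * q.1 -> planar g w p q -> axial tau eps rho g n.
Proof.
move=> wn w1 det [hU hV hW].
exists (fun k => (k, 0, 0)), w, eps.1.1; split=> //.
- by move=> k k' [].
- by move=> k; rewrite -(lift_block_shift hU); congr (block g _).
have axis a : block g a != 0 ->
    [/\ a.1.2 = 0, a.2 = 0, eps.1.2 = false & eps.2 = false].
  move=> nz; have := lift_block_dot tau_nonreal rho_lift (oner_neq0 _) hV nz.
  have := lift_block_dot tau_nonreal rho_lift (oner_neq0 _) hW nz.
  rewrite /momentum_dot /= !mulr0 !addr0 !add0r !mulr1.
  set y := _ + half R eps.1.2; set t := _ + half R eps.2.
  set A := y + _; set r := complex.Re tau; set s := complex.Im tau => eW eV.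
  (* [A] and [B] are the inner products of the momentum with the directions of V and W; invariance
     is a linear system in them with matrix A - 1. *)
  pose B := r * A + s * s * t.
  have e1 : (p.1 - 1)%:~R * A + p.2%:~R * B = 0 by rewrite rmorphB/= /B; lra.
  have e2 : q.1%:~R * A + (q.2 - 1)%:~R * B = 0 by rewrite rmorphB/= /B; lra.
  have dR : (p.1 - 1)%:~R * (q.2 - 1)%:~R - p.2%:~R * q.1%:~R != 0 :> R.
    by rewrite -!rmorphM -rmorphB intr_eq0 subr_eq0.
  have A0 : A = 0.
    apply: (mulfI dR); rewrite mulr0.
    transitivity ((q.2 - 1)%:~R * ((p.1 - 1)%:~R * A + p.2%:~R * B) -
       p.2%:~R * (q.1%:~R * A + (q.2 - 1)%:~R * B)); first by ring.
    by rewrite e1 e2 !mulr0 subrr.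
  have B0 : B = 0.
    apply: (mulfI dR); rewrite mulr0.
    transitivity ((p.1 - 1)%:~R * (q.1%:~R * A + (q.2 - 1)%:~R * B) -
       q.1%:~R * ((p.1 - 1)%:~R * A + p.2%:~R * B)); first by ring.
    by rewrite e1 e2 !mulr0 subrr.
  have t0 : t = 0.
    move: B0; rewrite /B A0 mulr0 add0r => /eqP.
    by rewrite !mulf_eq0 (negbTE tau_nonreal) => /eqP.
  have y0 : y = 0 by move: A0; rewrite /A t0 mulr0 addr0.
  by have [-> ->] := half_int_eq0 y0; have [-> ->] := half_int_eq0 t0.
(* A transverse shift by 1/2 leaves the axis without modes, and then all blocks vanish. *)
have [e23|e23] := boolP (eps.1.2 || eps.2).
  left=> a; apply/eqP; apply: contraTT e23 => /axis[_ _ -> ->] //.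
move: e23; rewrite negb_or => /andP[/negbTE e2 /negbTE e3]; right.
exists (clifford 1 0); split=> [k|k|a /axis[]].
- rewrite dirac_symbolE /= e2 e3 /half !mul0r !addr0 rmorph0 mulr0 addr0.
  apply/matrixP => i j; rewrite !mxE.
  by case: ifP => _; case: ifP => _; rewrite ?rmorph0 ?rmorph1 ?mulr1 ?mulr0// mulrN mulr1.
- by rewrite /momentum_sqr /= e2 e3 /half !mul0r !addr0 !mulr0 addr0 expr0n !addr0.
- by case: a => [[k l] m] /= -> -> _ _; exists k.
Qed.

Hypothesis tauE : tau = 0 +i* 1.

Let half0 : half R false = 0.
Proof. by rewrite /half mul0r. Qed.

Lemma axial_V n g w c d : w ^+ n = 1 -> w != 1 -> c != 0 -> d != 0 ->
  intertwines rho g eU (c, - eU) -> intertwines rho g eV (w, eV) ->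
  intertwines rho g eW (d, - eW) -> axial tau eps rho g n.
Proof.
move=> wn w1 c0 d0 hU hV hW.
exists (fun k => (0, k, 0)), w, eps.1.2; split=> //.
- by move=> k k' [].
- by move=> k; rewrite -(lift_block_shift hV); congr (block g _).
have axis a : block g a != 0 ->
    [/\ a.1.1 = 0, a.2 = 0, eps.1.1 = false & eps.2 = false].
  move=> nz; have := lift_block_dot tau_nonreal rho_lift c0 hU nz.
  have := lift_block_dot tau_nonreal rho_lift d0 hW nz.
  rewrite /momentum_dot tauE /=.
  set x := _ + half R eps.1.1; set t := _ + half R eps.2 => eW eU.
  have x0 : x = 0 by move: eU; rewrite !mulr0 !mul0r; lra.
  have t0 : t = 0 by move: eW; rewrite !mulr0 !mul0r; lra.
  by have [-> ->] := half_int_eq0 x0; have [-> ->] := half_int_eq0 t0.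
have [e23|e23] := boolP (eps.1.1 || eps.2).
  left=> a; apply/eqP; apply: contraTT e23 => /axis[_ _ -> ->] //.
move: e23; rewrite negb_or => /andP[/negbTE e1 /negbTE e3]; right.
exists (clifford 0 1); split=> [k|k|a /axis[]].
- rewrite dirac_symbolE /= e1 e3 half0 !addr0 rmorph0 mulr0 addr0.
  apply/matrixP => i j; rewrite !mxE.
  case: ifP => _; case: ifP => _; rewrite ?rmorph0 ?oppr0 ?mulr0 ?mulr1//.
  by rewrite conjc1 conjc_real mulr1.
- by rewrite /momentum_sqr tauE /= e1 e3 half0 !addr0 !mulr0 addr0 expr0n add0r addr0.
- by case: a => [[k l] m] /= -> -> _ _; exists l.
Qed.

Lemma axial_W n g w c d : w ^+ n = 1 -> w != 1 -> c != 0 -> d != 0 ->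
  intertwines rho g eU (c, - eU) -> intertwines rho g eV (d, - eV) ->
  intertwines rho g eW (w, eW) -> axial tau eps rho g n.
Proof.
move=> wn w1 c0 d0 hU hV hW.
exists (fun k => (0, 0, k)), w, eps.2; split=> //.
- by move=> k k' [].
- by move=> k; rewrite -(lift_block_shift hW); congr (block g _).
have axis a : block g a != 0 ->
    [/\ a.1.1 = 0, a.1.2 = 0, eps.1.1 = false & eps.1.2 = false].
  move=> nz; have := lift_block_dot tau_nonreal rho_lift c0 hU nz.
  have := lift_block_dot tau_nonreal rho_lift d0 hV nz.
  rewrite /momentum_dot tauE /=.
  set x := _ + half R eps.1.1; set y := _ + half R eps.1.2 => eV eU.
  have x0 : x = 0 by move: eU; rewrite !mulr0 !mul0r; lra.
  have y0 : y = 0 by move: eV; rewrite !mulr0 !mul0r; lra.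
  by have [-> ->] := half_int_eq0 x0; have [-> ->] := half_int_eq0 y0.
have [e23|e23] := boolP (eps.1.1 || eps.1.2).
  left=> a; apply/eqP; apply: contraTT e23 => /axis[_ _ -> ->] //.
move: e23; rewrite negb_or => /andP[/negbTE e1 /negbTE e2]; right.
exists (clifford 0 tau); split=> [k|k|a /axis[]].
- rewrite dirac_symbolE /= e1 e2 half0 !addr0 rmorph0 add0r.
  apply/matrixP => i j; rewrite !mxE.
  case: ifP => _; case: ifP => _; rewrite ?rmorph0 ?oppr0 ?mulr0 ?mulr1//.
    by rewrite rmorphM mulrC; congr (_ * _); exact: conjc_real.
  by rewrite mulrC.
- by rewrite /momentum_sqr tauE /= e1 e2 half0; ring.
- by case: a => [[k l] m] /= -> -> _ _; exists m.
Qed.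

End Axes.

(** * The nontrivial elements of the five groups *)

Section GroupCases.
Variable R : realType.
Variables (tau : R[i]) (eps : spinstr).
Hypothesis tau_nonreal : complex.Im tau != 0.

Local Notation zeta n := (root_of_unity R n).

(** Meant for the j-th power of the generator of a cyclic group. Its phase need not be a primitive
    n-th root of unity; being different from 1 is enough for mean zero over n steps. *)
Lemma planar_root_axial (M : bieberbach) (rho : bgroup M -> spinor R -> spinor R)
    n j g p q : spin_lift tau eps rho -> (0 < j < n)%N ->
  (p.1 - 1) * (q.2 - 1) != p.2 * q.1 ->
  planar rho g (zeta n ^+ j) p q -> axial tau eps rho g n.
Proof.
move=> rho_lift jn det; have n0 : (0 < n)%N by case/andP: jn => _; case: (n).
apply: planar_axial => //; last exact: root_of_unityX_neq1.
by rewrite exprAC root_of_unityX// expr1n.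
Qed.

Lemma axial_G2 (rho : bgroup G2 -> spinor R -> spinor R) g :
  spin_lift tau eps rho -> g != 1%g -> axial tau eps rho g 2.
Proof.
move=> rho_lift g1; have := lift_equivariant rho_lift (mem_head _ _).
set e : bgroup G2 := (X in rho X) => he.
have pl : planar rho e (zeta 2 ^+ 1) (-1, 0) (0, -1).
  by rewrite expr1 root_of_unity2; split=> psi /he[].
have : g = 1%g \/ g = e.
  by case: (g) => [[|[|//]] lt]; [left|right]; apply/val_inj.
by case=> ge; move: g1; rewrite ge ?eqxx// => _; apply: planar_root_axial pl.
Qed.

Lemma axial_G3 (rho : bgroup G3 -> spinor R -> spinor R) g :
  spin_lift tau eps rho -> g != 1%g -> axial tau eps rho g 3.
Proof.
move=> rho_lift g1; have := lift_equivariant rho_lift (mem_head _ _).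
set e : bgroup G3 := (X in rho X) => he.
have pl : planar rho e (zeta 3 ^+ 1) (0, -1) (1, -1) by split=> psi /he[].
have pl2 : planar rho (e * e)%g (zeta 3 ^+ 2) (-1, 1) (-1, 0).
  exact: (planar_comp rho_lift pl pl).
have : [\/ g = 1%g, g = e | g = (e * e)%g].
  by case: (g) => [[|[|[|//]]] lt];
    [constructor 1|constructor 2|constructor 3]; apply/val_inj.
case=> ge; move: g1; rewrite ge ?eqxx// => _.
  exact: (planar_root_axial rho_lift _ _ pl).
exact: (planar_root_axial rho_lift _ _ pl2).
Qed.

Lemma axial_G4 (rho : bgroup G4 -> spinor R -> spinor R) g :
  spin_lift tau eps rho -> g != 1%g -> axial tau eps rho g 4.
Proof.
move=> rho_lift g1; have := lift_equivariant rho_lift (mem_head _ _).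
set e : bgroup G4 := (X in rho X) => he.
have pl : planar rho e (zeta 4 ^+ 1) (0, 1) (-1, 0).
  by rewrite expr1 root_of_unity4; split=> psi /he[].
have pl2 : planar rho (e * e)%g (zeta 4 ^+ 2) (-1, 0) (0, -1).
  exact: (planar_comp rho_lift pl pl).
have pl3 : planar rho (e * e * e)%g (zeta 4 ^+ 3) (0, -1) (1, 0).
  exact: (planar_comp rho_lift pl pl2).
have : [\/ g = 1%g, g = e, g = (e * e)%g | g = (e * e * e)%g].
  by case: (g) => [[|[|[|[|//]]]] lt];
    [constructor 1|constructor 2|constructor 3|constructor 4]; apply/val_inj.
case=> ge; move: g1; rewrite ge ?eqxx// => _.
- exact: (planar_root_axial rho_lift _ _ pl).
- exact: (planar_root_axial rho_lift _ _ pl2).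
- exact: (planar_root_axial rho_lift _ _ pl3).
Qed.

Lemma axial_G5 (rho : bgroup G5 -> spinor R -> spinor R) g :
  spin_lift tau eps rho -> g != 1%g -> axial tau eps rho g 6.
Proof.
move=> rho_lift g1; have := lift_equivariant rho_lift (mem_head _ _).
set e : bgroup G5 := (X in rho X) => he.
have pl : planar rho e (zeta 6 ^+ 1) (0, 1) (-1, 1).
  by rewrite expr1 root_of_unity6; split=> psi /he[].
have pl2 : planar rho (e * e)%g (zeta 6 ^+ 2) (-1, 1) (-1, 0).
  exact: (planar_comp rho_lift pl pl).
have pl3 : planar rho (e * e * e)%g (zeta 6 ^+ 3) (-1, 0) (0, -1).
  exact: (planar_comp rho_lift pl pl2).
have pl4 : planar rho (e * e * e * e)%g (zeta 6 ^+ 4) (0, -1) (1, -1).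
  exact: (planar_comp rho_lift pl pl3).
have pl5 : planar rho (e * e * e * e * e)%g (zeta 6 ^+ 5) (1, -1) (1, 0).
  exact: (planar_comp rho_lift pl pl4).
have : g = 1%g \/ [\/ g = e, g = (e * e)%g, g = (e * e * e)%g |
                      g = (e * e * e * e)%g \/ g = (e * e * e * e * e)%g].
  by case: (g) => [[|[|[|[|[|[|//]]]]]] lt];
    [left|right; constructor 1|right; constructor 2|right; constructor 3
    |right; constructor 4; left|right; constructor 4; right]; apply/val_inj.
case=> [|[|||[]]] ge; move: g1; rewrite ge ?eqxx// => _.
- exact: (planar_root_axial rho_lift _ _ pl).
- exact: (planar_root_axial rho_lift _ _ pl2).
- exact: (planar_root_axial rho_lift _ _ pl3).
- exact: (planar_root_axial rho_lift _ _ pl4).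
- exact: (planar_root_axial rho_lift _ _ pl5).
Qed.

(** The elements [e1], [e2] and [e2 * e1] are half-turns about the directions of U, V and W, each
    with phase -1 along its own axis. *)
Lemma axial_G6 (rho : bgroup G6 -> spinor R -> spinor R) g : tau = 0 +i* 1 ->
  spin_lift tau eps rho -> g != 1%g -> axial tau eps rho g 4.
Proof.
move=> tauE rho_lift g1; have he1 := lift_equivariant rho_lift (mem_head _ _).
set e1 : bgroup G6 := (X in rho X) in he1.
pose e2 : bgroup G6 := (0, 1).
have m2 : (e2, ((1, - eU) : monomial R, (-1, eV) : monomial R, (-1, - eW) : monomial R))
    \in gen_action R G6 by rewrite in_cons mem_head orbT.
have he2 := lift_equivariant rho_lift m2.
have m1 : (-1 : R[i]) != 1.
  by rewrite -root_of_unity2 -[X in X != 1]expr1 root_of_unityX_neq1.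
(* The phases have order 2, but the period is taken to be |G| = 4, uniformly in the group
   elements. *)
have m4 : (-1 : R[i]) ^+ 4 = 1 by rewrite -signr_odd.
have n1 : (-1 : R[i]) != 0 by rewrite oppr_eq0 oner_eq0.
have i1 : (1 : R[i]) != 0 by exact: oner_neq0.
have hU1 : intertwines rho e1 eU (-1, eU) by move=> psi /he1[].
have hV1 : intertwines rho e1 eV (1, - eV) by move=> psi /he1[].
have hW1 : intertwines rho e1 eW (1, - eW) by move=> psi /he1[].
have hU2 : intertwines rho e2 eU (1, - eU) by move=> psi /he2[].
have hV2 : intertwines rho e2 eV (-1, eV) by move=> psi /he2[].
have hW2 : intertwines rho e2 eW (-1, - eW) by move=> psi /he2[].
have hV2' : intertwines rho e2 (- eV) (-1, - eV).
  by have := intertwinesN n1 hV2; rewrite invrN1.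
have hW2' : intertwines rho e2 (- eW) (-1, eW).
  by have := intertwinesN n1 hW2; rewrite invrN1 opprK.
have : [\/ g = 1%g, g = e1, g = e2 | g = (e2 * e1)%g].
  case: (g) => [[[|[|//]] lt] [[|[|//]] lt']];
    [constructor 1|constructor 3|constructor 2|constructor 4];
    by congr (_, _); apply/val_inj.
case=> ge; move: g1; rewrite ge ?eqxx// => _.
- have pl : planar rho e1 (-1) (-1, 0) (0, -1) by split.
  exact: (planar_axial tau_nonreal rho_lift m4 m1 _ pl).
- exact: (axial_V tau_nonreal rho_lift tauE m4 m1 _ _ hU2 hV2 hW2).
- apply: (axial_W tau_nonreal rho_lift tauE m4 m1 _ _
    (intertwines_comp rho_lift hU1 hU2) (intertwines_comp rho_lift hV1 hV2') _).
  + by rewrite mulr1.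
  + by rewrite mul1r.
  + by have := intertwines_comp rho_lift hW1 hW2'; rewrite mul1r.
Qed.

Lemma axial_bgroup (M : bieberbach) (rho : bgroup M -> spinor R -> spinor R) g :
  (M = G2 \/ M = G6 -> tau = 0 +i* 1) -> spin_lift tau eps rho -> g != 1%g ->
  axial tau eps rho g #|bgroup M|.
Proof.
case: M rho g => rho g tauE rho_lift g1.
- by rewrite [#|_|](card_ord 2); exact: axial_G2.
- by rewrite [#|_|](card_ord 3); exact: axial_G3.
- by rewrite [#|_|](card_ord 4); exact: axial_G4.
- by rewrite [#|_|](card_ord 6); exact: axial_G5.
- rewrite (_ : #|bgroup G6| = 4%N); first by apply: axial_G6 => //; apply: tauE; right.
  by rewrite [#|_|]card_prod !card_ord.
Qed.

End GroupCases.

(** * Spectral actions *)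

Section SpectralAction.
Variable R : realType.
Variables (tau : R[i]) (eps : spinstr).

(** This extends the sums from the two spectra, which differ for M and the torus, to all of [R],
    where they can be compared term by term. *)
Lemma multiplicity_notin_spectrum (H : set (spinor R)) lam :
  ~ spectrum tau eps H lam -> multiplicity tau eps H lam = 0%N.
Proof.
move=> nspec; rewrite /multiplicity; case: xgetP => // -[//|m] _ [b [free E]].
case: nspec; exists (b ord0).
  rewrite E /=; exists (fun i => (i == ord0)%:R).
  rewrite (bigD1 ord0)//= scale1r big1 ?addr0// => i /negbTE ->.
  by rewrite scale0r.
apply/eqP => b0; have s0 : \sum_(i < m.+1) (i == ord0)%:R *: b i = 0.
  by rewrite big1// => i _; case: eqP => [->|_]; rewrite ?b0 ?scaler0 ?scale0r.
by have /eqP := free _ s0 ord0; rewrite eqxx oner_eq0.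
Qed.

Let spectral_term0 (H : set (spinor R)) f L lam :
  ~ spectrum tau eps H lam -> spectral_term tau eps H f L lam = 0.
Proof. by rewrite /spectral_term => /multiplicity_notin_spectrum ->; rewrite mul0r. Qed.

Lemma spectral_actionE (H : set (spinor R)) f L :
  spectral_action tau eps H f L = rsum setT (spectral_term tau eps H f L).
Proof. exact: rsum_supp (@spectral_term0 H f L). Qed.

Variables (M : bieberbach) (rho : bgroup M -> spinor R -> spinor R) (f : R -> R).
Hypothesis tau_nonreal : complex.Im tau != 0.
Hypothesis tau_G2_G6 : M = G2 \/ M = G6 -> tau = 0 +i* 1.
Hypothesis rho_lift : spin_lift tau eps rho.
Hypothesis f_poisson : poisson_applicable f.
Hypothesis f_decay : abs_fourier f =o_+oo (fun xi : R => xi ^- 2).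
Hypothesis f_conv : forall L : R, 0 < L ->
  spectral_action_converges tau eps (@l2 R) f L.

Let n := #|bgroup M|.
Let n0 : (0 < n)%N.
Proof. by apply/card_gt0P; exists 1%g. Qed.

(** Real parts are taken because the multiplicities are real and [oscillating] is about real
    weights; periodicity and mean zero were established for them in [axial_oscillating]. *)
Let h (g : bgroup M) (lam : R) : R := complex.Re (eigen_trace eps rho tau_nonreal g lam).

Let h_oscillating g : g != 1%g -> oscillating n (h g).
Proof. by move=> g1; apply: axial_oscillating n0 _; exact: axial_bgroup. Qed.

Lemma multiplicity_split lam :
  n%:R * (multiplicity tau eps (invariant_spinors rho) lam)%:R =
  (multiplicity tau eps (@l2 R) lam)%:R + \sum_(g | g != 1%g) h g lam.
Proof.
have ReN k : complex.Re (k%:R : R[i]) = k%:R by rewrite -(rmorph_nat (real_complex R)).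
have := multiplicity_quotient tau_nonreal rho_lift lam.
rewrite (bigD1 1%g)//= -(multiplicity_torus tau_nonreal rho_lift) -natrM.
move=> /(congr1 (@complex.Re R)); rewrite ReN natrM => ->.
rewrite (raddfD (@complex.Re R : Rcomplex R -> R)) /= ReN; congr (_ + _).
exact: (raddf_sum (@complex.Re R : Rcomplex R -> R)).
Qed.

Let summable_torus L : 0 < L -> abs_summable setT (spectral_term tau eps (@l2 R) f L).
Proof. by move=> /f_conv; exact/abs_summable_supp/spectral_term0. Qed.

Let summable_h L : 0 < L -> forall g, g != 1%g ->
  abs_summable setT (fun x => h g x * f (x / L)).
Proof.
by move=> L0 g /h_oscillating hg; exact: (oscillating_summable f_poisson n0 hg L0).
Qed.

Lemma spectral_action_split L : 0 < L ->
  spectral_action tau eps (invariant_spinors rho) f L =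
  n%:R^-1 * spectral_action tau eps (@l2 R) f L +
  n%:R^-1 * \sum_(g | g != 1%g) rsum setT (fun x => h g x * f (x / L)).
Proof.
move=> L0; have sT := summable_torus L0; have sh := summable_h L0.
rewrite !spectral_actionE -mulrDr -(rsum_sum _ sh).
(* The terms for M are [n^-1] times those of a sum of summable families, so summability over M is
   inherited from the torus and the oscillating weights. *)
rewrite -(rsumD sT (abs_summable_sum _ sh)) -rsumZ; last first.
  by apply: abs_summableD => //; exact: abs_summable_sum.
apply: eq_rsum => lam _; rewrite /spectral_term -mulr_suml -mulrDl -multiplicity_split.
by rewrite -mulrA mulKf// pnatr_eq0 -lt0n.
Qed.

Lemma oscillating_part_le (e : R) : 0 < e -> exists2 K : R, 0 < K & forall L, K <= L ->
  `|n%:R^-1 * \sum_(g | g != 1%g) rsum setT (fun x => h g x * f (x / L))| <= e / L.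
Proof.
move=> e0.
have /(_ _)/cid-/all_sig[K hK] : forall g, exists K : R, 0 < K /\ forall L, K <= L ->
    g != 1%g -> `|rsum setT (fun x => h g x * f (x / L))| <= e / L.
  move=> g; have [g1|/negPn g1] := boolP (g != 1%g); last first.
    by exists 1; split=> // L _; rewrite g1.
  have [K K0 KP] := oscillating_rsum_le f_poisson f_decay n0 (h_oscillating g1) e0.
  by exists K; split=> // L /KP.
have K0 g : 0 < K g by case: (hK g).
(* The thresholds are positive, so their sum exceeds each of them; the factor [n^-1] absorbs the
   number of group elements. *)
exists (\sum_g K g).
  by rewrite (bigD1 1%g)//= ltr_wpDr ?K0// sumr_ge0// => g _; rewrite ltW.
move=> L KL; have KgL g : K g <= L.
  by apply: le_trans KL; rewrite (bigD1 g)//= lerDl sumr_ge0// => g' _; rewrite ltW.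
have L0 := lt_le_trans (K0 1%g) (KgL 1%g).
have eL : 0 <= e / L by rewrite divr_ge0 ?ltW.
have nR : 0 < n%:R :> R by rewrite ltr0n.
rewrite normrM gtr0_norm ?invr_gt0// ler_pdivrMl//.
apply: (le_trans (ler_norm_sum _ _ _)).
apply: (@le_trans _ _ (\sum_(g : bgroup M) e / L)); last first.
  by rewrite sumr_const -[X in _ *+ X]/n mulr_natl.
rewrite big_mkcond; apply: ler_sum => g _; case: ifP => // g1.
by apply: (hK g).2 => //; rewrite g1.
Qed.

End SpectralAction.

Theorem theorem4p1 (R : realType) (M : bieberbach) (tau : R[i])
    (eps : spinstr) (rho : bgroup M -> spinor R -> spinor R) (f : R -> R)
    (tau_norm : `|tau| = 1) (tau_nonreal : complex.Im tau != 0)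
    (tau_G2_G6 : M = G2 \/ M = G6 -> tau = 0 +i* 1)
    (rho_lift : spin_lift tau eps rho)
    (f_cont : continuous f)
    (f_poisson : poisson_applicable f)
    (f_decay : abs_fourier f =o_+oo (fun xi : R => xi ^- 2))
    (f_conv : forall L : R, 0 < L ->
       spectral_action_converges tau eps (@l2 R) f L) :
  (fun L : R => spectral_action tau eps (invariant_spinors rho) f L) =
  (fun L : R => #|bgroup M|%:R^-1 * spectral_action tau eps (@l2 R) f L)
    +o_+oo (fun L : R => L^-1).
Proof.
apply/eqaddoP => e e0.
have [K K0 hK] := oscillating_part_le tau_nonreal tau_G2_G6 rho_lift f_poisson f_decay e0.
exists K; split=> [|L KL]; first exact: num_real.
have L0 := lt_trans K0 KL.
rewrite [X in `|X|](_ : _ = spectral_action tau eps (invariant_spinors rho) f L -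
  #|bgroup M|%:R^-1 * spectral_action tau eps (@l2 R) f L)//.
rewrite (spectral_action_split tau_nonreal tau_G2_G6 rho_lift f_poisson f_conv L0).
by rewrite addrAC subrr add0r (gtr0_norm (x := L^-1)) ?invr_gt0// hK// ltW.
Qed.
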